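(* The approximate Newton algorithm described in the context (with its Armijo stepsize rule and scalars $\bar\alpha>0$, $\beta,\sigma\in(0,1)$), applied to the QE manifold $\mathcal M_{\rm QE}$ with the cost function $f_{\rm QE}(\mathbf u)=\|\mathbf A\mathbf u-\mathbf b\|_2^2$ and a retraction $\mathcal R\in\{\mathcal R^{\rm QE}_1,\mathcal R^{\rm QE}_2\}$, is a Riemannian approximate Newton method, with guaranteed descent (at each iteration) and local superlinear convergence rate.
   Context: Network. A radial distribution network is a tree rooted at the slack node $0$, with remaining nodes $\mathcal J=\{1,\dots,J\}$. For $j\in\mathcal J$, $i=i(j)$ is its parent (upstream node), line $j$ is the edge from $i(j)$ to $j$, and $\mathcal J'(j)=\{j'\in\mathcal J: i(j')=j\}$. Parameters: $r_j,x_j$ (series resistance and reactance), $a_j$ (transformer tap ratio), $G_j,B_j$ (shunt admittance $G_j-\sqrt{-1}\,B_j$), $v_0$ (fixed slack squared voltage magnitude), and known net real and reactive injections $p_j,q_j$. Variables: real and reactive flows $P_j,Q_j$ at the sending end of line $j$, squared current magnitudes $l_j$, squared voltage magnitudes $v_j$. The Branch Flow Model equations are, for all $j\in\mathcal J$ and $i=i(j)$: $$\begin{aligned}&\textstyle\sum_{j'\in\mathcal J'(j)}P_{j'}-P_j+a_j^2r_jl_j+G_jv_j=p_j, &(R)\\ &\textstyle\sum_{j'\in\mathcal J'(j)}Q_{j'}-Q_j+a_j^2x_jl_j-B_jv_j=q_j, &(I)\\ &v_j=\tfrac{v_i}{a_j^2}-2(r_jP_j+x_jQ_j)+a_j^2(r_j^2+x_j^2)l_j,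 &(V)\\ &v_il_j=P_j^2+Q_j^2. &(C)\end{aligned}$$ Standing assumption: a feasible load flow solution, i.e. a solution of these equations, exists (so the minimum of $f_{\rm QE}$ on the manifold is zero). Manifold and cost. Let $\mathbf u=(\mathbf P^T,\mathbf Q^T,\mathbf l^T,\mathbf v^T)^T\in\mathbb R^{4J}$. The linear equations (R), (I), (V) for all $j$ are written $\mathbf A\mathbf u=\mathbf b$, where $\mathbf A$ is $3J\times4J$ and $\mathbf b\in\mathbb R^{3J}$ includes the parameters $p_j,q_j$. Writing (C) for all $j$ as $\mathbf F_{\rm QE}(\mathbf u)=\mathbf 0$, $\mathcal M_{\rm QE}=\{\mathbf u\in\mathbb R^{4J}:\mathbf F_{\rm QE}(\mathbf u)=\mathbf 0\}$, regarded as a smooth Riemannian manifold of the Euclidean space with the dot product as metric. For a manifold $\mathcal M$ given by $\mathbf h(\mathbf u)=\mathbf 0$, $\mathcal T_{\mathbf u}\mathcal M=\{\boldsymbol\zeta:\mathrm D\mathbf h(\mathbf u)[\boldsymbol\zeta]=\mathbf 0\}$, $\mathbf\Pi_{\mathbf u}$ is the orthogonal projection onto $\mathcal T_{\mathbf u}\mathcal M$, $\mathrm{grad} f(\mathbf u)=\mathbf\Pi_{\mathbf u}\nabla f(\mathbf u)$ is the Riemannian gradient ($\nabla f$ the Euclidean gradient), and $\mathrm{hess} f(\mathbf u)[\boldsymbol\zeta]=\mathbf\Pi_{\mathbf u}\,\mathrm D\,\mathrm{grad} f(\mathbf u)[\boldsymbol\zeta]$, for $\boldsymbol\zeta\in\mathcal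 T_{\mathbf u}\mathcal M$, is the Riemannian Hessian. Retractions. Given $\mathbf u\in\mathcal M_{\rm QE}$ and $\boldsymbol\zeta\in\mathcal T_{\mathbf u}\mathcal M_{\rm QE}$, put $\tilde{\mathbf u}=\mathbf u+\boldsymbol\zeta$, with components $\tilde P_j,\tilde Q_j,\tilde l_j,\tilde v_j$, and $\tilde v_0=v_0$. With $i=i(j)$, $\mathcal R^{\rm QE}_{1,\mathbf u}(\boldsymbol\zeta)$ has components $$v_j^+=\tilde v_j,\quad l_j^+=\frac{D_j+\tilde l_j-\tilde v_i}{D_j-\tilde l_j+\tilde v_i}\tilde v_i,\quad P_j^+=\frac{2\tilde P_j\tilde v_i}{D_j-\tilde l_j+\tilde v_i},\quad Q_j^+=\frac{2\tilde Q_j\tilde v_i}{D_j-\tilde l_j+\tilde v_i},\quad D_j=\sqrt{4\tilde P_j^2+4\tilde Q_j^2+(\tilde l_j-\tilde v_i)^2},$$ and $\mathcal R^{\rm QE}_{2,\mathbf u}(\boldsymbol\zeta)$ has components $$v_j^+=\tilde v_j,\quad P_j^+=\tilde P_j,\quad Q_j^+=\tilde Q_j,\quad l_j^+=\frac{\tilde P_j^2+\tilde Q_j^2}{\tilde v_i}.$$ Algorithm. Inputs: scalars $\bar\alpha>0$, $\beta,\sigma\in(0,1)$, and small $\epsilon>0$; output: a critical point $\mathbf u^*\in\mathcal M_{\rm QE}$ of $f_{\rm QE}$. Start at $\mathbf u_0\in\mathcal M_{\rm QE}$. While $\|\mathrm{grad} f_{\rm QE}(\mathbf u_k)\|_2>\epsilon$: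 find a direction $\boldsymbol\zeta_k\in\mathcal T_{\mathbf u_k}\mathcal M_{\rm QE}$ with $f_{\rm QE}(\mathbf u_k+\boldsymbol\zeta_k)=0$, i.e. $\boldsymbol\zeta_k\in\mathbb R^{4J}$ solves the linear system $$\boldsymbol\zeta_k\in\mathcal T_{\mathbf u_k}\mathcal M_{\rm QE},\qquad \mathbf A(\mathbf u_k+\boldsymbol\zeta_k)=\mathbf b;$$ then set $\mathbf u_{k+1}=\mathcal R_{\mathbf u_k}(\beta^m\bar\alpha\boldsymbol\zeta_k)$, where $m$ is the smallest nonnegative integer satisfying the Armijo rule $f_{\rm QE}(\mathbf u_k)-f_{\rm QE}(\mathcal R_{\mathbf u_k}(\beta^m\bar\alpha\boldsymbol\zeta_k))\ge-\sigma\langle\mathrm{grad} f_{\rm QE}(\mathbf u_k),\beta^m\bar\alpha\boldsymbol\zeta_k\rangle$; increase $k$ by 1. (Remark: if the rows of the linear system are linearly independent, its solution can be viewed as that of minimizing $f_{\rm QE}(\mathbf u_k+\boldsymbol\zeta)$ over $\boldsymbol\zeta\in\mathcal T_{\mathbf u_k}\mathcal M_{\rm QE}$.) Terminology. Riemannian approximate Newton method: the directions satisfy $[\mathrm{hess} f(\mathbf u_k)+\mathbf E_k]\boldsymbol\zeta_k=-\mathrm{grad} f(\mathbf u_k)$, where the approximation error $\mathbf E_k$ has sufficiently small bounds to preserve superlinear convergence, namely $\|\mathbf E_k\|_2\le\gamma\|\mathrm{grad} f(\mathbf u_k)\|_2$ for some constant $\gamma$. Guaranteed descent: at every iterate that is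 not a load flow solution, $\langle\mathrm{grad} f(\mathbf u_k),\boldsymbol\zeta_k\rangle<0$ and $f(\mathbf u_{k+1})<f(\mathbf u_k)$. Local superlinear convergence rate: the iterates of the algorithm (leaving the stopping test aside), started sufficiently close to the solution $\mathbf u^*$, converge to it superlinearly, $\|\mathbf u_{k+1}-\mathbf u^*\|/\|\mathbf u_k-\mathbf u^*\|\to0$ (unless $\mathbf u^*$ is reached exactly).
   Formalization: Superlinear rate only for scalars where the full step 1 is the one accepted near u* (σ<1/2 if ᾱ=1); local claims need independent rows at u* and positive sending-end v_i; γ is per compact set with independent rows; Hessian equation needs DF_QE onto; Armijo step existence needs positive v_i. *)

(* Defs.v *)
From HB Require Import structures.
From mathcomp Require Import all_boot all_order all_algebra.
From mathcomp Require Import all_classical all_reals all_analysis.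
From mathcomp Require Import ring lra.

Set Implicit Arguments.
Unset Strict Implicit.
Unset Printing Implicit Defensive.

Import Order.TTheory GRing.Theory Num.Theory.
Import numFieldNormedType.Exports.

Local Open Scope classical_set_scope.
Local Open Scope ring_scope.

(* Vectors are row vectors. The library norm `|u| on 'rV[R]_n is the max norm,
   hence the explicit Euclidean norm. *)

Definition dotp (R : realType) (n : nat) (u w : 'rV[R]_n) : R :=
  \sum_k u 0 k * w 0 k.

Definition l2norm (R : realType) (n : nat) (u : 'rV[R]_n) : R :=
  Num.sqrt (dotp u u).

Definition opnorm2 (R : realType) (n : nat) (E : 'M[R]_n) : R :=
  sup [set l2norm (z *m E) | z in [set z | l2norm z <= 1]].

(** Riemannian geometry of a level set h = 0 *)

(* zeta *m jacobian h u = 'd h u zeta, so the row space of [tangent h u] is the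
   kernel of the differential. *)
Definition tangent (R : realType) (n m : nat) (h : 'rV[R]_n -> 'rV[R]_m)
    (u : 'rV[R]_n) : 'M[R]_n :=
  kermx (jacobian h u).

(* The projector onto T along T^\perp = {w | w *m T^T = 0}, acting on the
   right of row vectors. *)
Definition tproj (R : realType) (n m : nat) (h : 'rV[R]_n -> 'rV[R]_m)
    (u : 'rV[R]_n) : 'M[R]_n :=
  proj_mx (tangent h u) (kermx (tangent h u)^T).

Definition euclidean_gradient (R : realType) (n : nat) (f : 'rV[R]_n -> R)
    (u : 'rV[R]_n) : 'rV[R]_n :=
  \row_k 'D_(delta_mx 0 k) f u.

Definition rgrad (R : realType) (n m : nat) (h : 'rV[R]_n -> 'rV[R]_m)
    (f : 'rV[R]_n -> R) (u : 'rV[R]_n) : 'rV[R]_n :=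
  euclidean_gradient f u *m tproj h u.

Definition rhess (R : realType) (n m : nat) (h : 'rV[R]_n -> 'rV[R]_m)
    (f : 'rV[R]_n -> R) (u zeta : 'rV[R]_n) : 'rV[R]_n :=
  'd (rgrad h f) u zeta *m tproj h u.

(** Radial network *)

(* Nodes other than the slack node are 'I_J; the slack node is [None], and
   [parent j = None] means that line j leaves the slack node. *)
Record network (R : realType) (J : nat) := Network {
  parent : 'I_J -> option 'I_J;
  res : 'I_J -> R;
  rea : 'I_J -> R;
  tap : 'I_J -> R;
  shG : 'I_J -> R;
  shB : 'I_J -> R;
  v0 : R;
  injp : 'I_J -> R;
  injq : 'I_J -> R;
  parent_rooted : forall j, exists n, iter n (obind parent) (Some j) = None;
  tap_neq0 : forall j, tap j != 0
}.

(* u = (P, Q, l, v) is the concatenation of the four rows of a 4 x J matrix. *)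
Definition flowP (R : realType) (J : nat) (u : 'rV[R]_(4 * J)) (j : 'I_J) : R :=
  vec_mx u (inord 0 : 'I_4) j.
Definition flowQ (R : realType) (J : nat) (u : 'rV[R]_(4 * J)) (j : 'I_J) : R :=
  vec_mx u (inord 1 : 'I_4) j.
Definition sqcur (R : realType) (J : nat) (u : 'rV[R]_(4 * J)) (j : 'I_J) : R :=
  vec_mx u (inord 2 : 'I_4) j.
Definition volt (R : realType) (J : nat) (u : 'rV[R]_(4 * J)) (j : 'I_J) : R :=
  vec_mx u (inord 3 : 'I_4) j.

Definition mkstate (R : realType) (J : nat) (P Q l v : 'I_J -> R) :
    'rV[R]_(4 * J) :=
  mxvec (\matrix_(i < 4, j < J) nth 0 [:: P j; Q j; l j; v j] i).

Lemma mkstateE (R : realType) (J : nat) (P Q l v : 'I_J -> R) j :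
  [/\ flowP (mkstate P Q l v) j = P j, flowQ (mkstate P Q l v) j = Q j,
      sqcur (mkstate P Q l v) j = l j & volt (mkstate P Q l v) j = v j].
Proof. by rewrite /flowP /flowQ /sqcur /volt /mkstate mxvecK !mxE !inordK. Qed.

(* v_i for i = i(j), with v_0 the fixed slack value *)
Definition vup (R : realType) (J : nat) (N : network R J) (u : 'rV[R]_(4 * J))
    (j : 'I_J) : R :=
  if parent N j is Some i then volt u i else v0 N.

Definition eqC (R : realType) (J : nat) (N : network R J)
    (u : 'rV[R]_(4 * J)) (j : 'I_J) : Prop :=
  vup N u j * sqcur u j = flowP u j ^+ 2 + flowQ u j ^+ 2.

Definition load_flow_solution (R : realType) (J : nat) (N : network R J)
    (u : 'rV[R]_(4 * J)) : Prop :=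
  forall j : 'I_J,
  [/\ \sum_(k | parent N k == Some j) flowP u k - flowP u j
        + tap N j ^+ 2 * res N j * sqcur u j + shG N j * volt u j = injp N j,
      \sum_(k | parent N k == Some j) flowQ u k - flowQ u j
        + tap N j ^+ 2 * rea N j * sqcur u j - shB N j * volt u j = injq N j,
      volt u j = vup N u j / tap N j ^+ 2
        - 2 * (res N j * flowP u j + rea N j * flowQ u j)
        + tap N j ^+ 2 * (res N j ^+ 2 + rea N j ^+ 2) * sqcur u j &
      eqC N u j].

(* A u = b stacks the real balances, the reactive balances and the voltage
   drops; the slack voltage v_0 is a datum and goes to the right-hand side. *)
Definition linear_lhs (R : realType) (J : nat) (N : network R J)
    (u : 'rV[R]_(4 * J)) : 'rV[R]_(3 * J) :=
  mxvec (\matrix_(i < 3, j < J) nth 0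
    [:: \sum_(k | parent N k == Some j) flowP u k - flowP u j
          + tap N j ^+ 2 * res N j * sqcur u j + shG N j * volt u j;
        \sum_(k | parent N k == Some j) flowQ u k - flowQ u j
          + tap N j ^+ 2 * rea N j * sqcur u j - shB N j * volt u j;
        volt u j - (if parent N j is Some i then volt u i else 0) / tap N j ^+ 2
          + 2 * (res N j * flowP u j + rea N j * flowQ u j)
          - tap N j ^+ 2 * (res N j ^+ 2 + rea N j ^+ 2) * sqcur u j] i).

Definition matA (R : realType) (J : nat) (N : network R J) :
    'M[R]_(3 * J, 4 * J) :=
  (lin1_mx (linear_lhs N))^T.

Definition vecb (R : realType) (J : nat) (N : network R J) : 'rV[R]_(3 * J) :=
  mxvec (\matrix_(i < 3, j < J) nth 0
    [:: injp N j; injq N j;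
        (if parent N j is Some _ then 0 else v0 N) / tap N j ^+ 2] i).

(* A u - b, written for row vectors *)
Definition residual (R : realType) (J : nat) (N : network R J)
    (u : 'rV[R]_(4 * J)) : 'rV[R]_(3 * J) :=
  u *m (matA N)^T - vecb N.

Definition cost (R : realType) (J : nat) (N : network R J)
    (u : 'rV[R]_(4 * J)) : R :=
  l2norm (residual N u) ^+ 2.

Definition FQE (R : realType) (J : nat) (N : network R J)
    (u : 'rV[R]_(4 * J)) : 'rV[R]_J :=
  \row_j (vup N u j * sqcur u j - (flowP u j ^+ 2 + flowQ u j ^+ 2)).

Definition MQE (R : realType) (J : nat) (N : network R J) :
    set 'rV[R]_(4 * J) :=
  [set u | FQE N u = 0].

Definition tangentQE (R : realType) (J : nat) (N : network R J) :=
  tangent (FQE N).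

Definition gradQE (R : realType) (J : nat) (N : network R J) :=
  rgrad (FQE N) (cost N).

Definition hessQE (R : realType) (J : nat) (N : network R J) :=
  rhess (FQE N) (cost N).

Lemma linear_lhs_linear (R : realType) (J : nat) (N : network R J) :
  linear (linear_lhs N).
Proof.
move=> a u w; rewrite /linear_lhs -linearP; congr mxvec; apply/matrixP => i j.
have vE s : volt (a *: u + w) s = a * volt u s + volt w s by rewrite /volt linearP !mxE.
have PE s : flowP (a *: u + w) s = a * flowP u s + flowP w s by rewrite /flowP linearP !mxE.
have QE s : flowQ (a *: u + w) s = a * flowQ u s + flowQ w s by rewrite /flowQ linearP !mxE.
have lE s : sqcur (a *: u + w) s = a * sqcur u s + sqcur w s by rewrite /sqcur linearP !mxE.
rewrite !mxE.
under eq_bigr do rewrite PE.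
under [X in _ :: (X - _ + _ - _) :: _]eq_bigr do rewrite QE.
rewrite !big_split -!mulr_sumr /=.
case: i => [[|[|[|//]]] ?] /=; rewrite ?vE ?PE ?QE ?lE; [ring|ring|].
case: (parent N j) => [i|]; rewrite ?vE; ring.
Qed.

Lemma mulmx_matA (R : realType) (J : nat) (N : network R J) u :
  u *m (matA N)^T = linear_lhs N u.
Proof.
rewrite /matA trmxK.
pose f := GRing.isLinear.Build _ _ _ _ _ (linear_lhs_linear N).
pose g : {linear _ -> _} := HB.pack (linear_lhs N) f.
by rewrite (mul_rV_lin1 g).
Qed.

Lemma load_flow_solutionE (R : realType) (J : nat) (N : network R J) u :
  load_flow_solution N u <-> MQE N u /\ u *m (matA N)^T = vecb N.
Proof.
rewrite mulmx_matA /linear_lhs /vecb /MQE /=; split.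
  move=> H; split.
    by apply/rowP => j; rewrite !mxE; case: (H j) => _ _ _ ->; rewrite subrr.
  congr mxvec; apply/matrixP => i j; rewrite !mxE; have [h1 h2 h3 _] := H j.
  case: i => [[|[|[|//]]] ?] //=; rewrite h3 /vup; case: parent => *; ring.
move=> [/rowP F /(can_inj mxvecK)/matrixP E] j.
have := F j; rewrite !mxE => /subr0_eq FC.
have := E ord0 j; have := E (inord 1) j; have := E (inord 2) j.
rewrite !mxE !inordK //= => e3 e2 e1; split=> //.
move: e3; rewrite /vup; case: parent => [i|] /eqP; rewrite -subr_eq0 => /eqP e;
 apply/eqP; rewrite -subr_eq0 -e; apply/eqP; ring.
Qed.

(* F_QE is a submersion at u: M_QE is a J-codimensional manifold around u. *)
Definition regular_point (R : realType) (J : nat) (N : network R J)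
    (u : 'rV[R]_(4 * J)) : Prop :=
  row_free (jacobian (FQE N) u)^T.

(* The rows of the 4J x 4J linear system D F_QE(u)[zeta] = 0,
   A zeta = b - A u are linearly independent. *)
Definition independent_rows (R : realType) (J : nat) (N : network R J)
    (u : 'rV[R]_(4 * J)) : Prop :=
  row_free (col_mx (jacobian (FQE N) u)^T (matA N)).

(* Squared voltage magnitudes are positive at all sending ends. *)
Definition positive_voltages (R : realType) (J : nat) (N : network R J)
    (u : 'rV[R]_(4 * J)) : Prop :=
  forall j, 0 < vup N u j.

(** Retractions *)

Inductive retraction := QE1 | QE2.

Definition retD (R : realType) (J : nat) (N : network R J)
    (w : 'rV[R]_(4 * J)) (j : 'I_J) : R :=
  Num.sqrt (4 * flowP w j ^+ 2 + 4 * flowQ w j ^+ 2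
            + (sqcur w j - vup N w j) ^+ 2).

Definition retract (R : realType) (J : nat) (N : network R J)
    (ret : retraction) (u zeta : 'rV[R]_(4 * J)) : 'rV[R]_(4 * J) :=
  let w := u + zeta in
  let P := flowP w in let Q := flowQ w in
  let l := sqcur w in let vi := vup N w in let D := retD N w in
  match ret with
  | QE1 => mkstate
      (fun j => 2 * P j * vi j / (D j - l j + vi j))
      (fun j => 2 * Q j * vi j / (D j - l j + vi j))
      (fun j => (D j + l j - vi j) / (D j - l j + vi j) * vi j)
      (volt w)
  | QE2 => mkstate P Q (fun j => (P j ^+ 2 + Q j ^+ 2) / vi j) (volt w)
  end.

(* No formula of the retraction divides by zero (division is total here). *)
Definition retract_defined (R : realType) (J : nat) (N : network R J)
    (ret : retraction) (u zeta : 'rV[R]_(4 * J)) : Prop :=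
  let w := u + zeta in
  forall j, match ret with
            | QE1 => retD N w j - sqcur w j + vup N w j != 0
            | QE2 => vup N w j != 0
            end.

(** Algorithm *)

Definition newton_direction (R : realType) (J : nat) (N : network R J)
    (u zeta : 'rV[R]_(4 * J)) : Prop :=
  (zeta <= tangentQE N u)%MS /\ (u + zeta) *m (matA N)^T = vecb N.

(* xi is the trial step beta^m abar zeta *)
Definition armijo (R : realType) (J : nat) (N : network R J)
    (ret : retraction) (sigma : R) (u xi : 'rV[R]_(4 * J)) : Prop :=
  retract_defined N ret u xi /\
  cost N u - cost N (retract N ret u xi) >= - sigma * dotp (gradQE N u) xi.

Definition newton_step (R : realType) (J : nat) (N : network R J)
    (ret : retraction) (abar beta sigma : R)
    (u zeta u' : 'rV[R]_(4 * J)) : Prop :=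
  newton_direction N u zeta /\
  exists m : nat,
    [/\ armijo N ret sigma u ((beta ^+ m * abar) *: zeta),
        forall m' : nat, (m' < m)%N ->
          ~ armijo N ret sigma u ((beta ^+ m' * abar) *: zeta) &
        u' = retract N ret u ((beta ^+ m * abar) *: zeta)].

(* [u 0], ..., [u n] are the first n + 1 iterates and [zeta 0], ...,
   [zeta n.-1] the directions of a run; [stop = Some eps] is the stopping test
   with tolerance eps, [stop = None] leaves the test aside. *)
Definition newton_run (R : realType) (J : nat) (N : network R J)
    (ret : retraction) (abar beta sigma : R) (stop : option R) (n : nat)
    (u zeta : nat -> 'rV[R]_(4 * J)) : Prop :=
  MQE N (u 0%N) /\
  forall k, (k < n)%N ->
    (if stop is Some eps then eps < l2norm (gradQE N (u k)) : Prop else True) /\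
    newton_step N ret abar beta sigma (u k) (zeta k) (u k.+1).

(* Along a direction zeta at u, A (u + a zeta) - b = (1 - a) (A u - b), so
   close to a solution where the rows are independent the cost after a trial step a is
   (1 - a)^2 f(u) + o(f(u)) and the right-hand side of the Armijo rule is
   2 sigma a f(u): the trial is accepted if a < 2 (1 - sigma) and rejected if
   a > 2 (1 - sigma). The condition below says that the first accepted trial
   is then the full Newton step a = 1; for abar = 1 it reads sigma < 1/2. *)
Definition unit_step_scalars (R : realType) (abar beta sigma : R) : Prop :=
  sigma < 2^-1 /\
  exists n : nat, beta ^+ n * abar = 1 /\
    forall m : nat, (m < n)%N -> 2 * (1 - sigma) < beta ^+ m * abar.

Definition superlinear_to (R : realType) (n : nat) (u : nat -> 'rV[R]_n)
    (ustar : 'rV[R]_n) : Prop :=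
  (forall k, u k != ustar) ->
  (fun k => l2norm (u k.+1 - ustar) / l2norm (u k - ustar)) @ \oo --> (0 : R).

(* Main.v *)
Require Import Defs.
From HB Require Import structures.
From mathcomp Require Import all_boot all_order all_algebra.
From mathcomp Require Import all_classical all_reals all_analysis.
From mathcomp Require Import ring lra.

(** Write h = F_QE, r = A u - b, T for the kernel of D h(u) and Pi for the
    projector onto T.  Since h is quadratic, D h is affine in u.  The gradient
    of the cost on the manifold is Pi (2 A^T r) = 2 A^T r - D h(u)^T lam, lam
    being the least-squares multipliers; differentiating this identity and
    projecting kills every term ending in D h(u)^T, so that
    hess zeta = Pi (2 A^T A zeta) - Pi (D^2 h[zeta])^T lam.  A direction with
    A zeta = - r therefore solves the Newton equation up to
    E zeta = Pi (D^2 h[zeta])^T lam.  Where the rows of the linear system are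
    independent, (- lam, 2 r) is controlled by the gradient, its image under the
    transposed system; hence |E| = O(|grad|).

    Descent comes from <grad, zeta> = - 2 |r|^2.  Both retractions agree with
    u + zeta up to a bounded multiple of h(u + zeta), which is quadratic in a
    tangent zeta, so a trial step a leaves the residual (1 - a) r + O(a^2 |r|^2).
    Near a solution |r| is equivalent to the distance to it, the accepted steps
    are bounded below, and the cost decays geometrically; when the first accepted
    step is a = 1 the residual is O(|r|^2). *)

Set Implicit Arguments.
Unset Strict Implicit.
Unset Printing Implicit Defensive.

Import Order.TTheory GRing.Theory Num.Theory.
Import numFieldNormedType.Exports.

Local Open Scope classical_set_scope.
Local Open Scope ring_scope.

(** * Euclidean norm and differentials of matrix-valued maps *)

Section EuclideanNorm.
Variables (R : realType) (n : nat).
Implicit Types u w z : 'rV[R]_n.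

Lemma dotpE u w : dotp u w = (u *m w^T) 0 0.
Proof. by rewrite mxE; apply: eq_bigr => k _; rewrite mxE. Qed.

Lemma dotpC u w : dotp u w = dotp w u.
Proof. by apply: eq_bigr => k _; rewrite mulrC. Qed.

Lemma dotpDl u w z : dotp (u + w) z = dotp u z + dotp w z.
Proof. by rewrite !dotpE mulmxDl mxE. Qed.

Lemma dotpZl a u w : dotp (a *: u) w = a * dotp u w.
Proof. by rewrite !dotpE -scalemxAl mxE. Qed.

Lemma dotpDr u w z : dotp u (w + z) = dotp u w + dotp u z.
Proof. by rewrite dotpC dotpDl !(dotpC u). Qed.

Lemma dotpZr a u w : dotp u (a *: w) = a * dotp u w.
Proof. by rewrite dotpC dotpZl dotpC. Qed.

Lemma dotpNl u w : dotp (- u) w = - dotp u w.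
Proof. by rewrite -scaleN1r dotpZl mulN1r. Qed.

Lemma dotp_ge0 u : 0 <= dotp u u.
Proof. by apply: sumr_ge0 => k _; rewrite -expr2 sqr_ge0. Qed.

Lemma dotp_eq0 u : (dotp u u == 0) = (u == 0).
Proof.
apply/eqP/eqP => [/eqP|->]; last first.
  by rewrite /dotp big1// => k _; rewrite mxE mul0r.
rewrite psumr_eq0 => [/allP u0|k _]; last by rewrite -expr2 sqr_ge0.
apply/rowP => k; rewrite mxE; apply/eqP.
by have := u0 k (mem_index_enum _); rewrite -expr2 sqrf_eq0.
Qed.

Lemma sqr_l2norm u : l2norm u ^+ 2 = dotp u u.
Proof. by rewrite /l2norm sqr_sqrtr// dotp_ge0. Qed.

Lemma l2norm_ge0 u : 0 <= l2norm u.
Proof. exact: sqrtr_ge0. Qed.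

Lemma l2norm_eq0 u : (l2norm u == 0) = (u == 0).
Proof. by rewrite -sqrf_eq0 sqr_l2norm dotp_eq0. Qed.

Lemma l2norm0 : l2norm (0 : 'rV[R]_n) = 0.
Proof. by apply/eqP; rewrite l2norm_eq0. Qed.

Lemma l2normZ a u : l2norm (a *: u) = `|a| * l2norm u.
Proof.
by rewrite /l2norm dotpZl dotpZr mulrA -expr2 sqrtrM ?sqr_ge0// sqrtr_sqr.
Qed.

Lemma l2normN u : l2norm (- u) = l2norm u.
Proof. by rewrite -scaleN1r l2normZ normrN normr1 mul1r. Qed.

Lemma dotp_le_l2norm u w : dotp u w <= l2norm u * l2norm w.
Proof.
have [/eqP|u0] := eqVneq (l2norm u) 0.
  rewrite l2norm_eq0 => /eqP ->.
  by rewrite -(scale0r 0) dotpZl mul0r mulr_ge0 ?l2norm_ge0.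
have [/eqP|w0] := eqVneq (l2norm w) 0.
  rewrite l2norm_eq0 => /eqP ->.
  by rewrite -(scale0r 0) dotpZr mul0r mulr_ge0 ?l2norm_ge0.
have up : 0 < l2norm u by rewrite lt0r u0 l2norm_ge0.
have wp : 0 < l2norm w by rewrite lt0r w0 l2norm_ge0.
have := dotp_ge0 (l2norm w *: u - l2norm u *: w).
rewrite !(dotpDl, dotpDr) -!scaleNr !(dotpZl, dotpZr) -!sqr_l2norm (dotpC w u).
set a := l2norm u in up *; set b := l2norm w in wp *; set d := dotp u w.
move=> H; have : 0 <= (a * b) * (a * b - d) by lra.
by rewrite pmulr_rge0 ?mulr_gt0// subr_ge0.
Qed.

Lemma ler_l2normD u w : l2norm (u + w) <= l2norm u + l2norm w.
Proof.
rewrite -(@ler_pXn2r _ 2)// ?nnegrE ?addr_ge0 ?l2norm_ge0//.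
rewrite sqrrD !sqr_l2norm !(dotpDl, dotpDr) (dotpC w u).
have := dotp_le_l2norm u w; lra.
Qed.

Lemma ler_l2normB u w : l2norm u - l2norm w <= l2norm (u + w).
Proof. by rewrite lerBlDr -{1}(addrK w u) (le_trans (ler_l2normD _ _))// l2normN. Qed.

End EuclideanNorm.

(** * Max norm of matrices: products, transposes, comparison with the Euclidean norm *)

Section MatrixNorm.
Variable R : realType.

Lemma entry_le_mx_norm m n (A : 'M[R]_(m, n)) i j : `|A i j| <= `|A|.
Proof.
rewrite [leRHS]/Num.norm /= mx_normrE.
exact: (le_bigmax _ (fun ij : 'I_m * 'I_n => `|A ij.1 ij.2|) (i, j)).
Qed.

Lemma mx_norm_le m n (A : 'M[R]_(m, n)) c : 0 <= c ->
  (forall i j, `|A i j| <= c) -> `|A| <= c.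
Proof.
move=> c0 Ac; rewrite [leLHS]/Num.norm /= mx_normrE.
by apply: bigmax_le => // -[i j] _; exact: Ac.
Qed.

Lemma mx_norm_mulmx m n p (A : 'M[R]_(m, n)) (B : 'M[R]_(n, p)) :
  `|A *m B| <= n%:R * `|A| * `|B|.
Proof.
apply: mx_norm_le => [|i j]; first by rewrite !mulr_ge0.
rewrite mxE (le_trans (ler_norm_sum _ _ _))//.
apply: (@le_trans _ _ (\sum_(k < n) `|A| * `|B|)).
  by apply: ler_sum => k _; rewrite normrM ler_pM ?entry_le_mx_norm.
by rewrite sumr_const card_ord -mulrA mulr_natl.
Qed.

Lemma mx_norm_trmx m n (A : 'M[R]_(m, n)) : `|A^T| = `|A|.
Proof.
apply/le_anti/andP; split; apply: mx_norm_le => // i j.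
  by rewrite mxE entry_le_mx_norm.
by have := entry_le_mx_norm A^T j i; rewrite mxE.
Qed.

Lemma mx_norm_row_mx m n p (A : 'M[R]_(m, n)) (B : 'M[R]_(m, p)) :
  `|row_mx A B| <= `|A| + `|B|.
Proof.
apply: mx_norm_le => [|i j]; first exact: addr_ge0.
rewrite mxE; case: (fintype.split j) => k; rewrite (le_trans (entry_le_mx_norm _ _ _))//.
  by rewrite lerDl.
by rewrite lerDr.
Qed.

Lemma lsubmx_le_mx_norm m n p (A : 'M[R]_(m, n)) (B : 'M[R]_(m, p)) :
  `|A| <= `|row_mx A B|.
Proof.
by apply: mx_norm_le => // i j; rewrite -(row_mxEl A B) entry_le_mx_norm.
Qed.

Lemma mx_norm_le_l2norm n (u : 'rV[R]_n) : `|u| <= l2norm u.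
Proof.
apply: mx_norm_le => [|i j]; first exact: l2norm_ge0.
rewrite ord1 -(@ler_pXn2r _ 2)// ?nnegrE ?l2norm_ge0// sqr_l2norm real_normK ?num_real//.
by rewrite /dotp (bigD1 j)//= -expr2 lerDl sumr_ge0// => k _; rewrite -expr2 sqr_ge0.
Qed.

Lemma l2norm_le_mx_norm n (u : 'rV[R]_n) : l2norm u <= n%:R * `|u|.
Proof.
rewrite -(@ler_pXn2r _ 2)// ?nnegrE ?l2norm_ge0 ?mulr_ge0// sqr_l2norm.
apply: (@le_trans _ _ (\sum_(k < n) `|u| ^+ 2)).
  apply: ler_sum => k _; rewrite -expr2 -[leLHS]real_normK ?num_real//.
  by rewrite ler_pXn2r ?nnegrE// entry_le_mx_norm.
rewrite sumr_const card_ord exprMn -[leLHS]mulr_natl ler_wpM2r ?sqr_ge0// -natrX ler_nat.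
by case: (n) => // k; rewrite leq_pmulr.
Qed.

Lemma linear_rV_bounded n (W : normedModType R) (f : {linear 'rV[R]_n -> W}) :
  exists2 C, 0 < C & forall z, `|f z| <= C * `|z|.
Proof.
exists (\sum_j `|f (delta_mx 0 j)| + 1).
  by rewrite ltr_wpDl// sumr_ge0.
move=> z; rewrite {1}(row_sum_delta z) linear_sum (le_trans (ler_norm_sum _ _ _))//.
rewrite mulrDl mulr_suml (@le_trans _ _ (\sum_j `|f (delta_mx 0 j)| * `|z|))//.
  apply: ler_sum => j _; rewrite linearZ normrZ mulrC ler_wpM2l//.
  exact: entry_le_mx_norm.
by rewrite lerDl mulr_ge0.
Qed.

Lemma linear_rV_continuous n (W : normedModType R) (f : {linear 'rV[R]_n -> W}) :
  continuous f.
Proof.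
have [C C0 fC] := linear_rV_bounded f.
apply: bounded_linear_continuous; apply/linear_boundedP.
by near=> r => z; rewrite (le_trans (fC z))// ler_wpM2r.
Unshelve. all: by end_near. Qed.

End MatrixNorm.

(** * Differentials from quadratic remainders; stability of full row rank *)

Section Differentials.
Variable R : realType.

(** A quadratic remainder is o(z), and a continuous linear map with such a remainder is the
    differential. Every differential computed from an expansion below goes through this
    criterion. *)
Lemma is_diff_quadratic (V W : normedModType R) (f : V -> W)
    (df : {linear V -> W}) (x : V) (C : R) :
  continuous df ->
  (\forall z \near 0, `|f (x + z) - f x - df z| <= C * `|z| ^+ 2) ->
  is_diff x f df.
Proof.
move=> cdf fC.
have fE : f \o shift x = cst (f x) + df +o_ 0 id.
  apply/eqaddoP => e e0; near=> z.
  have -> : (f \o shift x - (cst (f x) + df)) z = f (x + z) - f x - df z.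
    by rewrite -[LHS]/(f (z + x) - (f x + df z)) opprD addrA [z + x]addrC.
  have zC : `|C| * `|z| <= e.
    have : `|z| < e / (`|C| + 1).
      by near: z; apply: nbhs0_lt; rewrite divr_gt0// ltr_wpDl.
    rewrite ltr_pdivlMr ?ltr_wpDl// mulrC mulrDl mul1r => /ltW; apply: le_trans.
    by rewrite lerDl.
  apply: (@le_trans _ _ (C * `|z| ^+ 2)); first by near: z.
  rewrite expr2 mulrA ler_wpM2r// (le_trans _ zC)// ler_wpM2r//; exact: ler_norm.
have dE := diff_unique cdf fE.
apply: DiffDef => //; apply/diff_locallyP; rewrite dE; split => //.
Unshelve. all: by end_near. Qed.

Lemma is_diff_quadraticT (V W : normedModType R) (f : V -> W)
    (df : {linear V -> W}) (x : V) (C : R) :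
  continuous df -> (forall z, `|f (x + z) - f x - df z| <= C * `|z| ^+ 2) ->
  is_diff x f df.
Proof. by move=> cdf fC; apply: (is_diff_quadratic (C := C)) => //; exact: nearW. Qed.

(** Differentiability is local. This matters for the Riemannian gradient, whose formula by
    multipliers is available only where the Gram matrix of the constraints is invertible. *)
Lemma near_eq_is_diff (V W : normedModType R) (f g : V -> W) (df : V -> W) (x : V) :
  (\forall w \near x, f w = g w) -> is_diff x f df -> is_diff x g df.
Proof.
move=> fg [/diff_locallyP[cdf fE] dfE].
have gE : g \o shift x = cst (g x) + 'd f x +o_ 0 id.
  apply/eqaddoP => e e0; move/eqaddoP/(_ e e0): fE.
  have /nbhs0P fg0 := fg; apply: filterS2 fg0 => z.
  by rewrite !fctE /= [x + z]addrC => ->; rewrite (nbhs_singleton fg).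
have dE := diff_unique cdf gE.
apply: DiffDef; last by rewrite dE.
by apply/diff_locallyP; rewrite dE; split.
Qed.

Lemma near_dist_le (V : normedModType R) (x : V) e :
  0 < e -> \forall y \near x, `|x - y| <= e.
Proof. by move=> e0; exact: (cvgr_dist_le (fun y => y) x cvg_id). Qed.

Lemma near_dist_fst (V W : normedModType R) (p : V * W) e :
  0 < e -> \forall q \near p, `|p.1 - q.1| <= e.
Proof.
by case: p => x y; apply: (@cvgr_dist_le R V _ (nbhs (x, y)) _ fst x); exact: cvg_fst.
Qed.

Lemma near_dist_snd (V W : normedModType R) (p : V * W) e :
  0 < e -> \forall q \near p, `|p.2 - q.2| <= e.
Proof.
by case: p => x y; apply: (@cvgr_dist_le R W _ (nbhs (x, y)) _ snd y); exact: cvg_snd.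
Qed.

Lemma mulmx_continuous m n p :
  continuous (fun AB : 'M[R]_(m, n) * 'M[R]_(n, p) => AB.1 *m AB.2).
Proof.
move=> [A B]; apply/cvgrPdist_le => e e0 /=.
pose c := n%:R * (`|A| + `|B| + 1) + 1.
have c0 : 0 < c by rewrite ltr_wpDl// mulr_ge0// !addr_ge0.
have [k k0 kE] : exists2 k, 0 < k & e / 2 = c * k.
  exists (e / c / 2); first by rewrite !divr_gt0.
  by field; rewrite gt_eqF.
have n0 : 0 <= n%:R :> R by [].
apply: filterS3 (near_dist_fst (A, B) k0) (near_dist_snd (A, B) k0)
  (near_dist_snd (A, B) ltr01) => AB /= h1 h2 h4.
have ABE : A *m B - AB.1 *m AB.2 = (A - AB.1) *m AB.2 + A *m (B - AB.2).
  by rewrite mulmxBl mulmxBr [RHS]addrC addrA subrK.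
have h3 : `|AB.2| <= `|B| + 1.
  by have := ler_normB B (B - AB.2); rewrite opprB addrC subrK; lra.
rewrite ABE (le_trans (ler_normD _ _))// (splitr e) kE lerD//.
  rewrite (le_trans (mx_norm_mulmx _ _))//.
  rewrite (@le_trans _ _ (n%:R * k * (`|B| + 1)))//.
    by rewrite ler_pM ?mulr_ge0// ler_wpM2l.
  rewrite mulrAC ler_wpM2r ?(ltW k0)// /c ler_wpDr// ler_wpM2l//.
  by have := normr_ge0 A; lra.
rewrite (le_trans (mx_norm_mulmx _ _))//.
rewrite (@le_trans _ _ (n%:R * `|A| * k))//.
  by rewrite ler_wpM2l ?mulr_ge0.
rewrite ler_wpM2r ?(ltW k0)// /c ler_wpDr// ler_wpM2l//.
by have := normr_ge0 B; lra.
Qed.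

Lemma is_diff_mulmx (V : normedModType R) m n p (A dA : V -> 'M[R]_(m, n))
    (B dB : V -> 'M[R]_(n, p)) (x : V) :
  is_diff x A dA -> is_diff x B dB ->
  is_diff x (fun w => A w *m B w) (fun z => A x *m dB z + dA z *m B x).
Proof.
move=> dAx dBx.
have mul_diff : is_diff (A x, B x)
    (fun AB : 'M[R]_(m, n) * 'M[R]_(n, p) => AB.1 *m AB.2)
    (fun AB => A x *m AB.2 + AB.1 *m B x).
  apply: DiffDef.
    exact: (@differentiable_bilin _ _ _ _ mulmx _ (@mulmx_continuous m n p)).
  by rewrite (@diff_bilin _ _ _ _ mulmx _ (@mulmx_continuous m n p)).
exact: (is_diff_comp (is_diff_pair dAx dBx) mul_diff).
Qed.

(** With a right inverse [B1] of [B], x = x B' B1 + x (B - B') B1; for [B'] close to [B] the last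
    term is at most |x| / 2 and is absorbed on the left. One constant thus serves a whole
    neighbourhood. *)
Lemma row_free_near m n (B : 'M[R]_(m, n)) : row_free B ->
  exists2 C, 0 < C &
    \forall B' \near B, forall x : 'rV[R]_m, `|x| <= C * `|x *m B'|.
Proof.
move=> /row_freeP[B1 BB1].
pose c := n%:R * `|B1| + 1.
have c0 : 0 < c by rewrite ltr_wpDl// mulr_ge0.
exists (2 * c); first by rewrite mulr_gt0.
have m0 : 0 <= m%:R :> R by [].
have d0 : 0 < (m%:R + 1)^-1 * (2 * c)^-1.
  by rewrite mulr_gt0// invr_gt0 ?mulr_gt0// ltr_wpDl.
apply: filterS (near_dist_le B d0) => B' hB x.
rewrite ler_pdivlMl ?ltr_wpDl// in hB.
have xE : x = x *m B' *m B1 + x *m (B - B') *m B1.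
  by rewrite -mulmxDl -mulmxDr addrC subrK -mulmxA BB1 mulmx1.
have b1 (y : 'rV[R]_n) : `|y *m B1| <= c * `|y|.
  rewrite (le_trans (mx_norm_mulmx _ _))// mulrAC ler_wpM2r//.
  by rewrite lerDl.
have b2 : `|x *m (B - B') *m B1| <= 2^-1 * `|x|.
  rewrite (le_trans (b1 _))//.
  rewrite (@le_trans _ _ (c * ((2 * c)^-1 * `|x|)))//.
    rewrite ler_pM2l// (le_trans (mx_norm_mulmx _ _))// mulrAC ler_wpM2r//.
    by rewrite (le_trans _ hB)// ler_wpM2r// lerDl.
  by rewrite mulrA invfM mulrCA divff ?gt_eqF// mulr1.
have : `|x| <= c * `|x *m B'| + 2^-1 * `|x|.
  by rewrite {1}xE (le_trans (ler_normD _ _))// lerD.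
by move=> ?; lra.
Qed.

Lemma row_free_lower_bound m n (B : 'M[R]_(m, n)) (C : R) :
  (forall x : 'rV[R]_m, `|x| <= C * `|x *m B|) -> row_free B.
Proof.
move=> BC; apply/row_freeP; exists (pinvmx B); apply/eqP; rewrite -subr_eq0.
apply/eqP/row_matrixP => i; rewrite row0; apply/eqP; rewrite -normr_le0.
rewrite (le_trans (BC _))// -row_mul mulmxBl mulmxKpV// mul1mx subrr row0.
by rewrite normr0 mulr0.
Qed.

(** The remainder X satisfies X (N + H) = N^-1 H N^-1 H, which is quadratic in H; the uniform lower
    bound for N + H transfers this to X. *)
Lemma is_diff_invmx n (N : 'M[R]_n) : N \in unitmx ->
  is_diff N invmx (fun H => - (invmx N *m H *m invmx N)).
Proof.
move=> uN.
have linf : linear (fun H => - (invmx N *m H *m invmx N)).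
  move=> a x y; rewrite mulmxDr mulmxDl -scalemxAr -scalemxAl opprD.
  by rewrite scalerN.
pose df : {linear 'M[R]_n -> 'M[R]_n} :=
  HB.pack (fun H => - (invmx N *m H *m invmx N))
    (GRing.isLinear.Build _ _ _ _ _ linf).
have [C C0 NC] : exists2 C, 0 < C &
    \forall B' \near N, forall x : 'rV[R]_n, `|x| <= C * `|x *m B'|.
  by apply: row_free_near; rewrite row_free_unit.
apply: (@is_diff_quadratic _ _ invmx df N
   (C * (n%:R ^+ 3 * `|invmx N| ^+ 2))).
  apply: bounded_linear_continuous; apply/linear_boundedP.
  near=> r => H; rewrite [df H]/= normrN.
  apply: (@le_trans _ _ ((n%:R * n%:R * `|invmx N| * `|invmx N|) * `|H|)).
    rewrite (le_trans (mx_norm_mulmx _ _))//.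
    rewrite (@le_trans _ _ (n%:R * (n%:R * `|invmx N| * `|H|) * `|invmx N|))//.
      by rewrite ler_wpM2r// ler_wpM2l// mx_norm_mulmx.
    by rewrite le_eqVlt; apply/orP; left; apply/eqP; ring.
  by rewrite ler_wpM2r//; near: r; apply: nbhs_pinfty_ge.
have : \forall z \near (0 : 'M[R]_n), forall x : 'rV[R]_n, `|x| <= C * `|x *m (N + z)|.
  by move/nbhs0P: NC.
apply: filterS => H NH; rewrite [df H]/=.
have uNH : N + H \in unitmx.
  by rewrite -row_free_unit; exact: row_free_lower_bound NH.
set X := (X in `|X|).
have XE : X *m (N + H) = invmx N *m H *m invmx N *m H.
  rewrite /X opprK !mulmxDl mulNmx mulVmx// !mulmxDr mulVmx//.
  rewrite -(mulmxA (invmx N *m H) (invmx N) N) mulVmx// mulmx1.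
  by rewrite opprD [_ + (- _ - _)]addrA subrr add0r addrA addNr add0r.
(* The lower bound is about row vectors, so it is applied to each row of X. *)
have XC : `|X| <= C * `|X *m (N + H)|.
  apply: mx_norm_le => [|i j]; first by rewrite mulr_ge0// ltW.
  have -> : X i j = row i X 0 j by rewrite [RHS]mxE.
  rewrite (le_trans (entry_le_mx_norm _ _ _))// (le_trans (NH _))// ler_pM2l//.
  rewrite -row_mul; apply: mx_norm_le => // k l; rewrite mxE.
  exact: entry_le_mx_norm.
rewrite (le_trans XC)// -mulrA ler_pM2l// XE.
rewrite (le_trans (mx_norm_mulmx _ _))//.
rewrite (@le_trans _ _ (n%:R * (n%:R * (n%:R * `|invmx N| * `|H|) * `|invmx N|) * `|H|))//.
  rewrite ler_wpM2r// ler_wpM2l// (le_trans (mx_norm_mulmx _ _))// ler_wpM2r//.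
  by rewrite ler_wpM2l// mx_norm_mulmx.
by rewrite le_eqVlt; apply/orP; left; apply/eqP; ring.
Unshelve. all: by end_near. Qed.

End Differentials.

(** * Orthogonal projection onto a tangent space *)

Section OrthogonalProjection.
Variables (R : realType) (n : nat) (T : 'M[R]_n).
Local Notation Pi := (proj_mx T (kermx T^T)).

Lemma dotp_orthogonal (u w : 'rV[R]_n) :
  (u <= T)%MS -> (w <= kermx T^T)%MS -> dotp u w = 0.
Proof.
move=> /submxP[a ->] /sub_kermxP wT; rewrite dotpC dotpE trmx_mul mulmxA wT.
by rewrite mul0mx mxE.
Qed.

Lemma capmx_orthogonal : (T :&: kermx T^T)%MS = 0.
Proof.
apply/eqP; rewrite -submx0; apply/rV_subP => v; rewrite sub_capmx.
case/andP => vT vp; have /eqP := dotp_orthogonal vT vp.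
by rewrite dotp_eq0 => /eqP ->; rewrite sub0mx.
Qed.

(** The two subspaces meet in 0 and their ranks add up to n, so their sum is everything. *)
Lemma submx_addsmx_orthogonal m (W : 'M[R]_(m, n)) : (W <= T + kermx T^T)%MS.
Proof.
apply: submx_full; rewrite -col_leq_rank mxrank_disjoint_sum ?capmx_orthogonal//.
by rewrite mxrank_ker mxrank_tr subnKC// rank_leq_row.
Qed.

Lemma proj_orthogonal_sub (w : 'rV[R]_n) : (w - w *m Pi <= kermx T^T)%MS.
Proof. exact: proj_mx_compl_sub (submx_addsmx_orthogonal w). Qed.

Lemma proj_orthogonal_id m (W : 'M[R]_(m, n)) : (W <= T)%MS -> W *m Pi = W.
Proof. exact/proj_mx_id/capmx_orthogonal. Qed.

Lemma proj_orthogonal_eq0 m (W : 'M[R]_(m, n)) :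
  (W <= kermx T^T)%MS -> W *m Pi = 0.
Proof. exact/proj_mx_0/capmx_orthogonal. Qed.

Lemma dotp_proj_orthogonal (w z : 'rV[R]_n) :
  (z <= T)%MS -> dotp (w *m Pi) z = dotp w z.
Proof.
move=> zT; rewrite -[in RHS](subrK (w *m Pi) w) dotpDl [X in X + _]dotpC.
by rewrite (dotp_orthogonal zT (proj_orthogonal_sub w)) add0r.
Qed.

Lemma l2norm_proj_orthogonal (w : 'rV[R]_n) : l2norm (w *m Pi) <= l2norm w.
Proof.
rewrite -(@ler_pXn2r _ 2)// ?nnegrE ?l2norm_ge0// !sqr_l2norm.
have wPi : (w *m Pi <= T)%MS by exact: proj_mx_sub.
have := dotp_orthogonal wPi (proj_orthogonal_sub w).
have : dotp w w = dotp (w - w *m Pi + w *m Pi) (w - w *m Pi + w *m Pi).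
  by rewrite subrK.
move: (w *m Pi) {wPi} => a; move: (w - a) => b ->; move=> ortho.
by rewrite !(dotpDl, dotpDr) (dotpC b a) ortho; have := dotp_ge0 b; lra.
Qed.

End OrthogonalProjection.

(** * Least-squares multipliers and the projection onto a kernel *)

Section Multipliers.
Variables (R : realType) (n m : nat) (D : 'M[R]_(n, m)).
Local Notation Pi := (proj_mx (kermx D) (kermx (kermx D)^T)).

(** Rows in the span of [D^T] are orthogonal to the kernel of [D]. This is the cancellation that
    removes the derivative of the multipliers from the Hessian. *)
Lemma proj_kermx_tr p (y : 'M[R]_(p, m)) : y *m D^T *m Pi = 0.
Proof.
apply: proj_orthogonal_eq0; apply/sub_kermxP.
by rewrite -mulmxA -trmx_mul mulmx_ker trmx0 mulmx0.
Qed.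

Lemma row_free_gram : row_free D^T -> D^T *m D \in unitmx.
Proof.
move=> fD; rewrite -row_free_unit -kermx_eq0; apply/eqP/row_matrixP => i.
rewrite row0; set x := row i _.
have xDD : x *m (D^T *m D) = 0 by apply/sub_kermxP/row_sub.
have : dotp (x *m D^T) (x *m D^T) == 0.
  by rewrite dotpE trmx_mul trmxK !mulmxA -(mulmxA x) xDD mul0mx mxE.
rewrite dotp_eq0 => /eqP xD; have /row_freeP[B DB] := fD.
by rewrite -[x]mulmx1 -DB mulmxA xD mul0mx.
Qed.

(** The solution of the normal equations lam (D^T D) = g D. *)
Definition multipliers (g : 'rV[R]_n) : 'rV[R]_m := g *m D *m invmx (D^T *m D).

Lemma proj_multipliers (g : 'rV[R]_n) :
  D^T *m D \in unitmx -> g *m Pi = g - multipliers g *m D^T.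
Proof.
move=> uD; rewrite -[in LHS](subrK (multipliers g *m D^T) g) mulmxDl.
rewrite proj_kermx_tr addr0 proj_orthogonal_id//; apply/sub_kermxP.
by rewrite mulmxBl -[X in _ - X]mulmxA mulmxKV// subrr.
Qed.

End Multipliers.

(** * Least-squares cost on a quadratic manifold *)

Section QuadraticConstraint.
Variables (R : realType) (n m p : nat).
Variables (h : 'rV[R]_n -> 'rV[R]_m) (D : 'rV[R]_n -> 'M[R]_(n, m)).
Variable L : {linear 'rV[R]_n -> 'M[R]_(n, m)}.
Variables (A : 'M[R]_(p, n)) (b : 'rV[R]_p).
(** Both expansions are exact: h is quadratic, [D u] is its Jacobian acting on row vectors from the
    right, and [L] is the constant second derivative. *)
Hypothesis DE : forall u z, D (u + z) = D u + L z.
Hypothesis hE : forall u z, h (u + z) = h u + z *m D u + 2^-1 *: (z *m L z).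

Local Notation res := (fun u : 'rV[R]_n => u *m A^T - b).
Local Notation f := (fun u : 'rV[R]_n => l2norm (u *m A^T - b) ^+ 2).
Local Notation lam u := (multipliers (D u) (2 *: (res u *m A))).
Local Notation Pi u := (proj_mx (kermx (D u)) (kermx (kermx (D u))^T)).

Lemma is_diff_affine (V : normedModType R) (F : 'rV[R]_n -> V)
    (dF : {linear 'rV[R]_n -> V}) u :
  (forall z, F (u + z) = F u + dF z) -> is_diff u F dF.
Proof.
move=> FE; apply: (@is_diff_quadraticT _ _ _ F dF u 0).
  exact: linear_rV_continuous.
by move=> z; rewrite FE [F u + _]addrC addrK subrr normr0 mul0r.
Qed.

Lemma is_diff_constraint u : is_diff u h (mulmxr (D u)).
Proof.
have [C C0 LC] := linear_rV_bounded L.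
apply: (@is_diff_quadraticT _ _ _ h (mulmxr (D u)) u (2^-1 * (n%:R * C))).
  exact: linear_rV_continuous.
move=> z; rewrite hE -[h u + _ + _]addrA [h u + _]addrC addrK [_ *m _ + _]addrC addrK.
rewrite normrZ ger0_norm// -mulrA ler_pM2l// (le_trans (mx_norm_mulmx _ _))//.
by rewrite expr2 -!mulrA ler_wpM2l// mulrC mulrA ler_wpM2r.
Qed.

Lemma jacobian_constraint u : jacobian h u = D u.
Proof.
rewrite /jacobian; apply/row_matrixP => i; rewrite !rowE mul_rV_lin1.
by case: (is_diff_constraint u) => _ ->.
Qed.

Lemma euclidean_gradient_cost u :
  euclidean_gradient f u = 2 *: (res u *m A).
Proof.
set g := 2 *: _.
have ling : linear (fun z => dotp g z).
  by move=> a x y; rewrite dotpDr dotpZr.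
pose df : {linear 'rV[R]_n -> R} :=
  HB.pack (fun z => dotp g z) (GRing.isLinear.Build _ _ _ _ _ ling).
have fE z : f (u + z) = f u + df z + l2norm (z *m A^T) ^+ 2.
  rewrite /= mulmxDl addrAC !sqr_l2norm /g dotpZl; move: (_ - b) => r.
  have -> : dotp (r *m A) z = dotp r (z *m A^T).
    by rewrite !dotpE trmx_mul trmxK mulmxA.
  rewrite !(dotpDl, dotpDr) (dotpC (z *m _) r); ring.
have [C C0 AC] := linear_rV_bounded (mulmxr A^T : 'rV_n -> 'rV_p).
have df_diff : is_diff u f df.
  apply: (@is_diff_quadraticT _ _ _ f df u ((p%:R * C) ^+ 2)).
    exact: linear_rV_continuous.
  move=> z; rewrite fE -[f u + _ + _]addrA [f u + _]addrC addrK [df z + _]addrC addrK.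
  rewrite ger0_norm ?sqr_ge0// -exprMn ler_pXn2r// ?nnegrE ?mulr_ge0 ?l2norm_ge0 ?(ltW C0)//.
  by rewrite (le_trans (l2norm_le_mx_norm _))// -mulrA ler_wpM2l// AC.
apply/rowP => k; rewrite [LHS]mxE deriveE; last exact: ex_diff.
rewrite diff_val /= /dotp (bigD1 k)//= big1 ?addr0.
  by rewrite [delta_mx 0 k 0 k]mxE !eqxx mulr1.
by move=> j /negPf jk; rewrite [delta_mx _ _ _ _]mxE jk andbF mulr0.
Qed.

Lemma rgrad_cost u : rgrad h f u = 2 *: (res u *m A) *m Pi u.
Proof. by rewrite /rgrad euclidean_gradient_cost /tproj /tangent jacobian_constraint. Qed.

Lemma rgrad_multipliers u : (D u)^T *m D u \in unitmx ->
  rgrad h f u = 2 *: (res u *m A) - lam u *m (D u)^T.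
Proof. by move=> uD; rewrite rgrad_cost proj_multipliers. Qed.

(** A tangent zeta does not see the projector, and moving A to the other side of the product turns
    zeta into - r. *)
Lemma dotp_rgrad_newton u zeta : zeta *m D u = 0 -> zeta *m A^T = - res u ->
  dotp (rgrad h f u) zeta = - 2 * l2norm (res u) ^+ 2.
Proof.
move=> zD zA; rewrite rgrad_cost dotp_proj_orthogonal; last exact/sub_kermxP.
rewrite dotpZl sqr_l2norm mulNr -mulrN; congr (_ * _).
rewrite -dotpNl dotpC dotpE trmx_mul mulmxA zA -dotpE.
by rewrite !dotpNl.
Qed.

(** The tangent part of the adjoint of the second derivative along z, applied to y: with y the
    multipliers it is the curvature term of the Hessian, up to sign. *)
Definition linear_derivative_tr (y : 'rV[R]_m) (u z : 'rV[R]_n) : 'rV[R]_n :=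
  y *m (L z)^T *m Pi u.

Lemma linear_derivative_tr_is_linear y u : linear (linear_derivative_tr y u).
Proof.
move=> a z w; rewrite /linear_derivative_tr !linearP /=.
by rewrite mulmxDl -scalemxAl.
Qed.

Definition newton_error (u : 'rV[R]_n) : 'M[R]_n :=
  lin1_mx (linear_derivative_tr (lam u) u).

Lemma mul_newton_error u z : z *m newton_error u = lam u *m (L z)^T *m Pi u.
Proof.
pose g : {linear 'rV[R]_n -> 'rV[R]_n} := HB.pack (linear_derivative_tr (lam u) u)
  (GRing.isLinear.Build _ _ _ _ _ (linear_derivative_tr_is_linear (lam u) u)).
by rewrite /newton_error (mul_rV_lin1 g).
Qed.

Lemma stablemx_newton_error u : stablemx (tangent h u) (newton_error u).
Proof.
rewrite /tangent jacobian_constraint (submx_trans (submxMl _ _))//.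
by apply/row_subP => i; rewrite rowE mul_newton_error proj_mx_sub.
Qed.

Lemma is_diff_jacobian u : is_diff u D L.
Proof. by apply: is_diff_affine => z; exact: DE. Qed.

Lemma rhess_newton u zeta : row_free (D u)^T -> zeta *m A^T = - res u ->
  rhess h f u zeta + zeta *m newton_error u = - rgrad h f u.
Proof.
move=> freeD zA.
have dD := is_diff_jacobian u.
have dDT : is_diff u (fun w => (D w)^T) (fun z => (L z)^T).
  by apply: (is_diff_affine (dF := trmx \o L)) => z; rewrite DE linearD.
have dg : is_diff u (fun w => 2 *: (res w *m A)) (fun z => 2 *: (z *m A^T *m A)).
  apply: (is_diff_affine (dF := ( *:%R 2) \o (mulmxr A \o mulmxr A^T))) => z.
  by rewrite /= -scalerDr -mulmxDl [(u + z) *m _]mulmxDl addrAC.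
have uM := row_free_gram freeD.
(* Invertibility of the Gram matrix persists near u, so the multiplier formula for the gradient
   holds on a neighbourhood and can be differentiated. *)
have [C C0 MC] : exists2 C, 0 < C & \forall B' \near (D u)^T *m D u,
    forall x : 'rV[R]_m, `|x| <= C * `|x *m B'|.
  by apply: row_free_near; rewrite row_free_unit.
have dM := is_diff_mulmx dDT dD.
have dinv := is_diff_comp dM (is_diff_invmx uM).
have dlam := is_diff_mulmx (is_diff_mulmx dg dD) dinv.
have dF := is_diffB dg (is_diff_mulmx dlam dDT).
have grad_eq : \forall w \near u,
    2 *: (res w *m A) - lam w *m (D w)^T = rgrad h f w.
  have [/differentiable_continuous/(_ _ MC) + _] := dM.
  apply: (@filterS _ (nbhs u)) => w Mw; rewrite rgrad_multipliers//.
  by rewrite -row_free_unit; exact: row_free_lower_bound Mw.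
have [_ dgrad] := near_eq_is_diff grad_eq dF.
rewrite /rhess dgrad /tproj /tangent jacobian_constraint rgrad_cost mul_newton_error.
(* The differential of the multipliers stands to the left of [(D u)^T] and is killed by the
   projector; the surviving curvature term cancels against the error. *)
rewrite !fctE [X in X + _]mulmxBl [X in _ - X]mulmxDl proj_kermx_tr addr0 subrK zA.
by rewrite mulNmx scalerN mulNmx.
Qed.

(** Writing the gradient as an image under the matrix of the linear system lets a lower bound for
    that matrix control the multipliers by the gradient. *)
Lemma rgrad_system u : (D u)^T *m D u \in unitmx ->
  rgrad h f u = row_mx (- lam u) (2 *: res u) *m col_mx (D u)^T A.
Proof.
by move=> uD; rewrite rgrad_multipliers// mul_row_col mulNmx addrC scalemxAl.
Qed.

Lemma row_free_col_mxl (k : nat) (B : 'M[R]_(m, n)) (B' : 'M[R]_(k, n)) :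
  row_free (col_mx B B') -> row_free B.
Proof.
move=> /row_freeP[X]; rewrite mul_col_mx -[X]hsubmxK !mul_mx_row.
rewrite scalar_mx_block -[LHS]/(block_mx _ _ _ _) => /eq_block_mx[BX _ _ _].
by apply/row_freeP; exists (lsubmx X).
Qed.

Local Notation system w := (col_mx (D w)^T A).

Lemma is_diff_system u : is_diff u (fun w => system w) (fun z => col_mx (L z)^T 0).
Proof.
have lin : linear (fun z => col_mx (L z)^T (0 : 'M[R]_(p, n))).
  by move=> a z w; rewrite scale_col_mx add_col_mx scaler0 addr0 !linearP.
pose dF : {linear 'rV[R]_n -> 'M[R]_(m + p, n)} :=
  HB.pack (fun z => col_mx (L z)^T (0 : 'M[R]_(p, n)))
    (GRing.isLinear.Build _ _ _ _ _ lin).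
by apply: (is_diff_affine (dF := dF)) => z; rewrite DE /= linearD add_col_mx addr0.
Qed.

Lemma opnorm2_newton_error : exists2 C, 0 < C &
  forall u, opnorm2 (newton_error u) <= C * `|lam u|.
Proof.
have [C C0 LC] := linear_rV_bounded L.
exists (n%:R * (m%:R * C) + 1); first by rewrite ltr_wpDl// !mulr_ge0// ltW.
move=> u; apply: ge_sup.
  by exists (l2norm (0 *m newton_error u)), 0 => //=; rewrite l2norm0.
move=> _ [z /= z1 <-]; rewrite mul_newton_error.
rewrite (le_trans (l2norm_proj_orthogonal _ _))//.
rewrite (le_trans (l2norm_le_mx_norm _))//.
have zn : `|z| <= 1 := le_trans (mx_norm_le_l2norm z) z1.
have Lz : `|L z| <= C by rewrite (le_trans (LC z))// ler_piMr// ltW.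
rewrite (@le_trans _ _ (n%:R * (m%:R * `|lam u| * C)))//.
  rewrite ler_wpM2l// (le_trans (mx_norm_mulmx _ _))// mx_norm_trmx.
  by rewrite ler_wpM2l ?mulr_ge0.
rewrite (_ : _ * (_ * _ * C) = n%:R * (m%:R * C) * `|lam u|); last by ring.
by rewrite mulrDl mul1r lerDl.
Qed.

Lemma newton_error_bound (K : set 'rV[R]_n) :
  compact K -> (forall w, K w -> row_free (system w)) ->
  exists gamma, forall w, K w ->
    opnorm2 (newton_error w) <= gamma * l2norm (rgrad h f w).
Proof.
move=> /compact_near_coveringP/near_covering_withinP cK Kfree.
have [C C0 EC] := opnorm2_newton_error.
(* Compactness is used as a near-covering along the filter at +oo in gamma: a bound valid near each
   point for all large gamma becomes one gamma valid on K. *)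
pose P (gamma : R) w := opnorm2 (newton_error w) <= gamma * l2norm (rgrad h f w).
suff [g gP] : exists g, K `<=` P g by exists g; exact: gP.
apply: (@filter_ex R (pinfty_nbhs R)); apply: (cK R (pinfty_nbhs R) P) => u Ku.
have [c c0 uc] := row_free_near (Kfree u Ku).
have [/differentiable_continuous/(_ _ uc) nu _] := is_diff_system u.
exists ([set w | forall x : 'rV[R]_(m + p), `|x| <= c * `|x *m system w|],
  [set g | C * c <= g]).
  by split => //=; exact/nbhs_pinfty_ge/num_real.
move=> [w g] /= [wc Cg] Kw; rewrite /P (le_trans (EC w))//.
have freeD := row_free_col_mxl (Kfree w Kw).
rewrite (@le_trans _ _ (C * (c * l2norm (rgrad h f w))))//.
  rewrite ler_pM2l// -normrN (le_trans (lsubmx_le_mx_norm _ (2 *: res w)))//.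
  rewrite (le_trans (wc _))// ler_pM2l// -rgrad_system ?row_free_gram//.
  exact: mx_norm_le_l2norm.
by rewrite mulrA ler_wpM2r ?l2norm_ge0.
Qed.

End QuadraticConstraint.

(** * The power flow manifold *)

Section Network.
Variables (R : realType) (J : nat) (N : network R J).
Implicit Types u w z : 'rV[R]_(4 * J).

Lemma flowP_linear j : scalar (fun u => flowP u j : R).
Proof. by move=> a u z; rewrite /flowP linearP !mxE. Qed.

Lemma flowQ_linear j : scalar (fun u => flowQ u j : R).
Proof. by move=> a u z; rewrite /flowQ linearP !mxE. Qed.

Lemma sqcur_linear j : scalar (fun u => sqcur u j : R).
Proof. by move=> a u z; rewrite /sqcur linearP !mxE. Qed.

Lemma volt_linear j : scalar (fun u => volt u j : R).
Proof. by move=> a u z; rewrite /volt linearP !mxE. Qed.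

(** The linear part of the affine map [vup]: the slack voltage is a constant and drops out. *)
Definition vup_lin u j : R := if parent N j is Some i then volt u i else 0.

Lemma vup_lin_linear j : scalar (fun u => vup_lin u j).
Proof.
move=> a u z; rewrite /vup_lin; case: parent => [i|]; first exact: volt_linear.
by rewrite mulr0 addr0.
Qed.

Lemma flowPD u z j : flowP (u + z) j = flowP u j + flowP z j.
Proof. by rewrite -[u]scale1r flowP_linear mul1r scale1r. Qed.

Lemma flowQD u z j : flowQ (u + z) j = flowQ u j + flowQ z j.
Proof. by rewrite -[u]scale1r flowQ_linear mul1r scale1r. Qed.

Lemma sqcurD u z j : sqcur (u + z) j = sqcur u j + sqcur z j.
Proof. by rewrite -[u]scale1r sqcur_linear mul1r scale1r. Qed.

Lemma voltD u z j : volt (u + z) j = volt u j + volt z j.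
Proof. by rewrite -[u]scale1r volt_linear mul1r scale1r. Qed.

Lemma vupD u z j : vup N (u + z) j = vup N u j + vup_lin z j.
Proof.
by rewrite /vup /vup_lin; case: parent => [i|]; rewrite ?voltD ?addr0.
Qed.

(* Twice the symmetric bilinear form of the quadratic part of F_QE. *)
Definition FQE_bilin u z : 'rV[R]_J :=
  \row_j (vup_lin u j * sqcur z j + vup_lin z j * sqcur u j
          - 2 * (flowP u j * flowP z j + flowQ u j * flowQ z j)).

(** It differs from [FQE_bilin] only in keeping the slack voltage, which is why it is affine and not
    linear in u. *)
Definition FQE_diff u z : 'rV[R]_J :=
  \row_j (vup N u j * sqcur z j + vup_lin z j * sqcur u j
          - 2 * (flowP u j * flowP z j + flowQ u j * flowQ z j)).

Lemma FQE_bilin_linear u : linear (FQE_bilin u).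
Proof.
move=> a z w; apply/rowP => j; rewrite !mxE.
by rewrite sqcur_linear vup_lin_linear flowP_linear flowQ_linear; ring.
Qed.

Lemma FQE_diff_linear u : linear (FQE_diff u).
Proof.
move=> a z w; apply/rowP => j; rewrite !mxE.
by rewrite sqcur_linear vup_lin_linear flowP_linear flowQ_linear; ring.
Qed.

Definition jacFQE u : 'M[R]_(4 * J, J) := lin1_mx (FQE_diff u).

Definition hessFQE u : 'M[R]_(4 * J, J) := lin1_mx (FQE_bilin u).

Lemma mul_jacFQE u z : z *m jacFQE u = FQE_diff u z.
Proof.
pose g : {linear _ -> _} :=
  HB.pack (FQE_diff u) (GRing.isLinear.Build _ _ _ _ _ (FQE_diff_linear u)).
by rewrite /jacFQE (mul_rV_lin1 g).
Qed.

Lemma mul_hessFQE u z : z *m hessFQE u = FQE_bilin u z.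
Proof.
pose g : {linear _ -> _} :=
  HB.pack (FQE_bilin u) (GRing.isLinear.Build _ _ _ _ _ (FQE_bilin_linear u)).
by rewrite /hessFQE (mul_rV_lin1 g).
Qed.

Lemma hessFQE_is_linear : linear hessFQE.
Proof.
move=> a z w; apply/matrixP => i j; rewrite !mxE.
by rewrite sqcur_linear vup_lin_linear flowP_linear flowQ_linear; ring.
Qed.

HB.instance Definition _ := GRing.isLinear.Build R 'rV[R]_(4 * J)
  'M[R]_(4 * J, J) _ hessFQE hessFQE_is_linear.

Lemma jacFQE_affine u z : jacFQE (u + z) = jacFQE u + hessFQE z.
Proof.
apply/matrixP => i j; rewrite !mxE.
by rewrite vupD sqcurD flowPD flowQD; ring.
Qed.

Lemma FQE_taylor u z :
  FQE N (u + z) = FQE N u + z *m jacFQE u + 2^-1 *: (z *m hessFQE z).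
Proof.
rewrite mul_jacFQE mul_hessFQE; apply/rowP => j; rewrite !mxE.
by rewrite vupD sqcurD flowPD flowQD; field.
Qed.

Lemma jacobian_FQE u : jacobian (FQE N) u = jacFQE u.
Proof. exact: (jacobian_constraint FQE_taylor). Qed.

Lemma newton_directionP u z : newton_direction N u z <->
  z *m jacFQE u = 0 /\ z *m (matA N)^T = - residual N u.
Proof.
rewrite /newton_direction /tangentQE /tangent jacobian_FQE /residual mulmxDl.
split=> [[/sub_kermxP -> <-]|[zD ->]]; split => //.
- by rewrite opprB addrAC subrr add0r.
- exact/sub_kermxP.
- by rewrite opprB addrC subrK.
Qed.

Lemma normr_flowP u j : `|flowP u j| <= `|u|.
Proof. by rewrite /flowP mxE entry_le_mx_norm. Qed.

Lemma normr_flowQ u j : `|flowQ u j| <= `|u|.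
Proof. by rewrite /flowQ mxE entry_le_mx_norm. Qed.

Lemma normr_sqcur u j : `|sqcur u j| <= `|u|.
Proof. by rewrite /sqcur mxE entry_le_mx_norm. Qed.

Lemma normr_volt u j : `|volt u j| <= `|u|.
Proof. by rewrite /volt mxE entry_le_mx_norm. Qed.

Lemma normr_vup_lin u j : `|vup_lin u j| <= `|u|.
Proof. by rewrite /vup_lin; case: parent => [i|]; rewrite ?normr_volt ?normr0. Qed.

Lemma state_norm_le u c : 0 <= c ->
  (forall j, [/\ `|flowP u j| <= c, `|flowQ u j| <= c,
                 `|sqcur u j| <= c & `|volt u j| <= c]) -> `|u| <= c.
Proof.
move=> c0 uc; apply: mx_norm_le => // i k; rewrite ord1 => {i}.
case/mxvec_indexP: k => i j; rewrite -[u]vec_mxK mxvecE.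
have [hP hQ hl hv] := uc j.
have [e|[e|[e|e]]] : i = inord 0 \/ i = inord 1 \/ i = inord 2 \/ i = inord 3.
  case: i => [[|[|[|[|//]]]] ?]; [left|right; left|right; right; left|right; right; right];
    by apply/val_inj; rewrite /= inordK.
all: by rewrite e.
Qed.

End Network.

(** * Scalar identities and estimates for the two retractions on a single line *)

Section RetractionCoordinates.
Variable R : realType.
Implicit Types a B c v l P Q D : R.

(** Since (D + l - v)(D - l + v) = D^2 - (l - v)^2, the defect of the constraint is a multiple of
    the defect of the equation defining D. *)
Lemma QE1_on_manifold v l P Q D :
  D ^+ 2 = 4 * P ^+ 2 + 4 * Q ^+ 2 + (l - v) ^+ 2 -> D - l + v != 0 ->
  v * ((D + l - v) / (D - l + v) * v) =
  (2 * P * v / (D - l + v)) ^+ 2 + (2 * Q * v / (D - l + v)) ^+ 2.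
Proof.
move=> DE d0; apply/eqP; rewrite -subr_eq0.
have -> : v * ((D + l - v) / (D - l + v) * v) -
  ((2 * P * v / (D - l + v)) ^+ 2 + (2 * Q * v / (D - l + v)) ^+ 2) =
  v ^+ 2 / (D - l + v) ^+ 2 *
  (D ^+ 2 - (4 * P ^+ 2 + 4 * Q ^+ 2 + (l - v) ^+ 2)) by field.
by rewrite DE subrr mulr0.
Qed.

(* With s = l + v, the discriminant is D^2 = s^2 - 4 c where c = v l - P^2 - Q^2
   is the violation of the constraint, so D - s = O(c), and every coordinate of
   the retraction moves by a bounded multiple of D - s. *)
Lemma QE1_coordinates a B v l P Q D c : 0 < a -> a <= v -> - (a / 2) <= l ->
  `|P| <= B -> `|Q| <= B -> `|l| <= B -> `|v| <= B ->
  c = v * l - (P ^+ 2 + Q ^+ 2) -> `|c| <= a ^+ 2 / 8 -> 0 <= D ->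
  D ^+ 2 = 4 * P ^+ 2 + 4 * Q ^+ 2 + (l - v) ^+ 2 ->
  [/\ D - l + v != 0,
      `|2 * P * v / (D - l + v) - P| <= 16 * B / a ^+ 2 * `|c|,
      `|2 * Q * v / (D - l + v) - Q| <= 16 * B / a ^+ 2 * `|c| &
      `|(D + l - v) / (D - l + v) * v - l| <= 16 * B / a ^+ 2 * `|c|].
Proof.
move=> a0 av al PB QB lB vB cE ca D0 DE.
have s0 : a / 2 <= l + v by lra.
have sum0 : a / 2 <= D + (l + v) by lra.
have DsE : (D - (l + v)) * (D + (l + v)) = - (4 * c).
  by rewrite -subr_sqr DE cE; ring.
have Ds : `|D - (l + v)| <= 8 / a * `|c|.
  have : `|D - (l + v)| * (a / 2) <= 4 * `|c|.
    rewrite -[4]ger0_norm// -normrM -[leRHS]normrN -DsE normrM ler_wpM2l//.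
    by rewrite (le_trans sum0)// ler_norm.
  rewrite -ler_pdivlMr ?divr_gt0// => /le_trans; apply.
  by rewrite le_eqVlt; apply/orP; left; apply/eqP; field; rewrite gt_eqF.
(* The denominator is 2 v + (D - s) with s = l + v; here 2 v is at least 2 a, and the bound on c
   gives |D - s| <= a. *)
have den : a <= D - l + v.
  have : 8 / a * `|c| <= a.
    rewrite mulrAC ler_pdivrMr//.
    by move: ca; rewrite ler_pdivlMr// -expr2 mulrC.
  by move=> h; move: Ds; rewrite ler_norml => /andP[? ?]; lra.
have den0 : 0 < D - l + v by lra.
have B0 : 0 <= B by rewrite (le_trans _ PB).
have inv : (D - l + v)^-1 <= a^-1 by rewrite lef_pV2// posrE.
(* Each displacement is x (D - s) / (D - l + v) with x one of - P, - Q, v - l; the constant is 2 B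
   times 8 / a times 1 / a. *)
have bnd x : `|x| <= 2 * B ->
    `|x * (D - (l + v)) / (D - l + v)| <= 16 * B / a ^+ 2 * `|c|.
  move=> xB; rewrite !normrM normfV (gtr0_norm den0).
  rewrite (@le_trans _ _ (2 * B * (8 / a * `|c|) / a))//.
    by rewrite ler_pM// ?mulr_ge0 ?invr_ge0 ?(ltW den0)// ler_pM.
  by rewrite le_eqVlt; apply/orP; left; apply/eqP; field; rewrite gt_eqF.
split; first by rewrite gt_eqF.
- rewrite (_ : _ - P = - P * (D - (l + v)) / (D - l + v)); last first.
    by field; rewrite gt_eqF.
  by apply: bnd; rewrite normrN; lra.
- rewrite (_ : _ - Q = - Q * (D - (l + v)) / (D - l + v)); last first.
    by field; rewrite gt_eqF.
  by apply: bnd; rewrite normrN; lra.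
- rewrite (_ : _ - l = (v - l) * (D - (l + v)) / (D - l + v)); last first.
    by field; rewrite gt_eqF.
  by apply: bnd; have := ler_normB v l; lra.
Qed.

(** Only l moves, by - c / v. The constant is weakened to the one for [QE1] so that both retractions
    share one estimate. *)
Lemma QE2_coordinate a B v l P Q c : 0 < a -> a <= v -> `|v| <= B ->
  c = v * l - (P ^+ 2 + Q ^+ 2) ->
  v != 0 /\ `|(P ^+ 2 + Q ^+ 2) / v - l| <= 16 * B / a ^+ 2 * `|c|.
Proof.
move=> a0 av vB cE; have v0 : 0 < v by lra.
split; first by rewrite gt_eqF.
rewrite (_ : _ - l = - c / v); last by rewrite cE; field; rewrite gt_eqF.
rewrite normrM normrN normfV (gtr0_norm v0) mulrC ler_wpM2r//.
rewrite (@le_trans _ _ a^-1)//; first by rewrite lef_pV2// posrE.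
rewrite -[leLHS]mul1r ler_pdivlMr ?exprn_gt0// mul1r expr2 mulrA mulVf ?gt_eqF//.
by move: vB; rewrite (gtr0_norm v0); lra.
Qed.

End RetractionCoordinates.

(** * Second-order retraction estimates *)

Section StateCoordinates.
Variables (R : realType) (J : nat) (P Q l v : 'I_J -> R) (j : 'I_J).

Lemma flowP_mkstate : flowP (mkstate P Q l v) j = P j.
Proof. by case: (mkstateE P Q l v j). Qed.

Lemma flowQ_mkstate : flowQ (mkstate P Q l v) j = Q j.
Proof. by case: (mkstateE P Q l v j). Qed.

Lemma sqcur_mkstate : sqcur (mkstate P Q l v) j = l j.
Proof. by case: (mkstateE P Q l v j). Qed.

Lemma volt_mkstate : volt (mkstate P Q l v) j = v j.
Proof. by case: (mkstateE P Q l v j). Qed.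

Definition mkstate_coordinates :=
  (flowP_mkstate, flowQ_mkstate, sqcur_mkstate, volt_mkstate).

End StateCoordinates.

Section Retraction.
Variables (R : realType) (J : nat) (N : network R J) (ret : retraction).
Implicit Types u w z zeta : 'rV[R]_(4 * J).

Lemma sqr_retD w j : retD N w j ^+ 2 =
  4 * flowP w j ^+ 2 + 4 * flowQ w j ^+ 2 + (sqcur w j - vup N w j) ^+ 2.
Proof.
rewrite /retD sqr_sqrtr//; have := sqr_ge0 (flowP w j).
by have := sqr_ge0 (flowQ w j); have := sqr_ge0 (sqcur w j - vup N w j); lra.
Qed.

Lemma retract_volt u zeta j :
  volt (retract N ret u zeta) j = volt (u + zeta) j.
Proof. by case: ret; rewrite /retract mkstate_coordinates. Qed.

Lemma retract_vup u zeta j :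
  vup N (retract N ret u zeta) j = vup N (u + zeta) j.
Proof. by rewrite /vup; case: parent => [i|//]; exact: retract_volt. Qed.

Lemma retract_MQE u zeta : retract_defined N ret u zeta ->
  MQE N (retract N ret u zeta).
Proof.
move=> dom; apply/rowP => j; rewrite !mxE retract_vup; apply/eqP.
rewrite subr_eq0; apply/eqP; move: dom => /(_ j).
case: (ret); rewrite /retract !mkstate_coordinates.
  by apply: QE1_on_manifold; exact: sqr_retD.
by move=> v0; rewrite mulrC divfK.
Qed.

(** There are finitely many lines; arguing with small a > 0 instead of a minimum also covers J =
    0. *)
Lemma positive_voltages_lower_bound u : positive_voltages N u ->
  exists2 a, 0 < a & forall j, a <= vup N u j.
Proof.
move=> posu.
have : \forall a \near 0^'+, forall j, a <= vup N u j.
  by apply: filter_forall => j; exact: nbhs_right_le.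
move=> H; have [a [a0 ?]] : exists a : R, 0 < a /\ forall j, a <= vup N u j.
  by apply: (@filter_ex _ 0^'+); near=> a; split; near: a; [exact: nbhs_right_gt|].
by exists a.
Unshelve. all: by end_near. Qed.

Lemma sqcur_ge0 u j : MQE N u -> positive_voltages N u -> 0 <= sqcur u j.
Proof.
move=> /rowP/(_ j); rewrite !mxE => /subr0_eq uC /(_ j) v0.
by rewrite -(pmulr_rge0 _ v0) uC addr_ge0 ?sqr_ge0.
Qed.

(** For u on the manifold and zeta tangent, the Taylor formula leaves only the second-order term of
    [FQE] at u + zeta; the scalar estimates convert this violation into a displacement of the same
    order. *)
Lemma retract_second_order ustar : MQE N ustar -> positive_voltages N ustar ->
  exists2 delta, 0 < delta & exists2 C, 0 < C & forall u zeta,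
    MQE N u -> `|u - ustar| < delta -> zeta *m jacFQE N u = 0 ->
    `|zeta| < delta ->
    retract_defined N ret u zeta /\
    `|retract N ret u zeta - (u + zeta)| <= C * `|zeta| ^+ 2.
Proof.
move=> Mstar posstar.
have [a a0 va] := positive_voltages_lower_bound posstar.
have [Ch Ch0 hC] := linear_rV_bounded (@hessFQE R J N).
pose Cq := 2^-1 * ((4 * J)%:R * Ch) + 1.
have Cq0 : 0 < Cq by rewrite ltr_wpDl// !mulr_ge0// ltW.
pose c := a / 2; have c0 : 0 < c by rewrite divr_gt0.
pose B := `|ustar| + `|v0 N| + 1.
have B0 : 0 < B by rewrite ltr_wpDl// addr_ge0.
pose K := 16 * B / c ^+ 2.
have K0 : 0 < K by rewrite divr_gt0 ?mulr_gt0 ?exprn_gt0.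
(* The point w = u + zeta is within 2 d of ustar. The three bounds keep w in the ball of radius 1
   (hence below B), keep its voltages above c and its currents above - c / 2, and make the violation
   at most c^2 / 8. *)
have [d d0 [d1 dc dq]] : exists2 d, 0 < d &
    [/\ d <= 2^-1, d <= c / 4 & Cq * d <= c ^+ 2 / 8].
  pose d := Num.min 2^-1 (Num.min (c / 4) (c ^+ 2 / 8 / Cq)).
  exists d; first by rewrite !lt_min invr_gt0 !divr_gt0 ?exprn_gt0 ?ltr0n.
  split; rewrite ?ge_min ?lexx ?orbT//.
  by rewrite -ler_pdivlMl// mulrC !ge_min lexx !orbT.
exists d => //; exists (K * Cq); first by rewrite mulr_gt0.
move=> u zeta Mu ud zD zd.
pose w := u + zeta.
have wstar : `|w - ustar| < 2 * d.
  rewrite /w addrAC (le_lt_trans (ler_normD _ _))//; lra.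
have FwE : FQE N w = 2^-1 *: (zeta *m hessFQE N zeta).
  by rewrite FQE_taylor Mu zD add0r add0r.
have Fw j : `|FQE N w 0 j| <= Cq * `|zeta| ^+ 2.
  rewrite (le_trans (entry_le_mx_norm _ _ _))// FwE normrZ ger0_norm//.
  apply: (@le_trans _ _ (2^-1 * ((4 * J)%:R * `|zeta| * (Ch * `|zeta|)))).
    rewrite ler_pM2l// (le_trans (mx_norm_mulmx _ _))//.
    by rewrite ler_wpM2l// hC.
  rewrite [leLHS](_ : _ = 2^-1 * ((4 * J)%:R * Ch) * `|zeta| ^+ 2); last by ring.
  by rewrite ler_wpM2r ?sqr_ge0// lerDl.
have Fsmall j : `|FQE N w 0 j| <= c ^+ 2 / 8.
  rewrite (le_trans (Fw j))// (le_trans _ dq)// ler_pM2l// expr2.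
  by rewrite (le_trans (ler_pM _ _ (ltW zd) (ltW zd)))//; nra.
have vw j : c <= vup N w j.
  have -> : w = ustar + (w - ustar) by rewrite addrC subrK.
  rewrite vupD; have := normr_vup_lin N (w - ustar) j.
  by have := va j; rewrite ler_norml => ? /andP[? ?]; rewrite /c in dc *; lra.
have lw j : - (c / 2) <= sqcur w j.
  have -> : w = ustar + (w - ustar) by rewrite addrC subrK.
  rewrite sqcurD; have := normr_sqcur (w - ustar) j.
  by have := sqcur_ge0 j Mstar posstar; rewrite ler_norml => ? /andP[? ?]; lra.
have wB : `|w| <= B.
  have -> : w = ustar + (w - ustar) by rewrite addrC subrK.
  by rewrite (le_trans (ler_normD _ _))// /B; have := normr_ge0 (v0 N); lra.
have vB j : `|vup N w j| <= B.
  rewrite /vup; case: parent => [i|]; first by rewrite (le_trans (normr_volt _ _)).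
  by rewrite /B; have := normr_ge0 ustar; lra.
have FE j : FQE N w 0 j =
    vup N w j * sqcur w j - (flowP w j ^+ 2 + flowQ w j ^+ 2) by rewrite mxE.
have PB j := le_trans (normr_flowP w j) wB.
have QB j := le_trans (normr_flowQ w j) wB.
have lB j := le_trans (normr_sqcur w j) wB.
have D0 j : 0 <= retD N w j by exact: sqrtr_ge0.
have coord1 j := QE1_coordinates c0 (vw j) (lw j) (PB j) (QB j) (lB j) (vB j)
  (FE j) (Fsmall j) (D0 j) (sqr_retD w j).
have coord2 j := QE2_coordinate c0 (vw j) (vB j) (FE j).
split.
  by move=> j; case: (ret); [case: (coord1 j)|case: (coord2 j)].
have bnd j x : `|x| <= K * `|FQE N w 0 j| -> `|x| <= K * Cq * `|zeta| ^+ 2.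
  by move=> /le_trans; apply; rewrite -mulrA ler_pM2l.
have KC0 : 0 <= K * Cq * `|zeta| ^+ 2.
  by rewrite mulr_ge0 ?sqr_ge0// mulr_ge0// ltW.
apply: state_norm_le => // j.
have sub (F : 'rV[R]_(4 * J) -> R) (x y : 'rV[R]_(4 * J)) :
    (forall a x y, F (a *: x + y) = a * F x + F y) -> F (x - y) = F x - F y.
  by move=> Flin; rewrite addrC -scaleN1r Flin mulN1r addrC.
rewrite (sub _ _ _ (flowP_linear j)) (sub _ _ _ (flowQ_linear j)).
rewrite (sub _ _ _ (sqcur_linear j)) (sub _ _ _ (volt_linear j)) -/w.
rewrite retract_volt subrr normr0; case: (ret); rewrite /retract -/w.
  rewrite !mkstate_coordinates; have [_ hP hQ hl] := coord1 j.
  by split; [exact: bnd hP|exact: bnd hQ|exact: bnd hl|].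
rewrite !mkstate_coordinates; have [_ hl] := coord2 j.
by rewrite !subrr !normr0; split => //; exact: bnd hl.
Qed.

End Retraction.

(** * Armijo rule and descent *)

Section Descent.
Variables (R : realType) (J : nat) (N : network R J) (ret : retraction).
Variables (abar beta sigma : R).
Hypotheses (abar0 : 0 < abar) (beta01 : 0 < beta < 1) (sigma01 : 0 < sigma < 1).
Implicit Types u w z zeta : 'rV[R]_(4 * J).
Local Notation step m := (beta ^+ m * abar).

Lemma step_gt0 m : 0 < step m.
Proof. by case/andP: beta01 => b0 _; rewrite mulr_gt0// exprn_gt0. Qed.

Lemma step_le m : step m <= abar.
Proof.
by case/andP: beta01 => b0 b1; rewrite ler_piMl ?(ltW abar0)// exprn_ile1// ltW.
Qed.

Lemma step_small e : 0 < e -> exists m, step m <= e.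
Proof.
move=> e0; case/andP: beta01 => b0 b1.
have bcvg : beta ^+ k @[k --> \oo] --> (0 : R).
  by apply: cvg_expr; rewrite ger0_norm ?(ltW b0).
move/cvgr0Pnorm_lt: bcvg => /(_ _ (divr_gt0 e0 abar0)) [k _ /(_ k (leqnn k))] /=.
rewrite ger0_norm ?exprn_ge0 ?(ltW b0)// ltr_pdivlMr// => h.
by exists k; exact: ltW.
Qed.

Lemma dotp_gradQE u zeta : newton_direction N u zeta ->
  dotp (gradQE N u) zeta = - 2 * cost N u.
Proof.
move=> /newton_directionP[zD zA].
exact: (dotp_rgrad_newton (@FQE_taylor R J N) zD zA).
Qed.

Lemma cost_gt0 u : MQE N u -> ~ load_flow_solution N u -> 0 < cost N u.
Proof.
move=> Mu nsol; rewrite lt0r sqr_ge0 andbT sqrf_eq0 l2norm_eq0.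
by apply/eqP => /subr0_eq Au; apply: nsol; apply/load_flow_solutionE.
Qed.

(** The slope along a Newton direction is - 2 f(u), so the Armijo rule is a bound on the ratio of
    the new cost to the old one. *)
Lemma armijoP u zeta t : newton_direction N u zeta ->
  armijo N ret sigma u (t *: zeta) <->
  retract_defined N ret u (t *: zeta) /\
  cost N (retract N ret u (t *: zeta)) <= (1 - 2 * sigma * t) * cost N u.
Proof.
move=> dir; rewrite /armijo dotpZr (dotp_gradQE dir).
by split=> -[? h]; split => //; move: h; lra.
Qed.

Lemma newton_step_MQE u zeta u' :
  newton_step N ret abar beta sigma u zeta u' -> MQE N u'.
Proof. by move=> [_ [m [[dom _] _ ->]]]; exact: retract_MQE. Qed.

Lemma newton_run_MQE stop n (u zeta : nat -> 'rV[R]_(4 * J)) :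
  newton_run N ret abar beta sigma stop n u zeta ->
  forall k, (k <= n)%N -> MQE N (u k).
Proof.
move=> [M0 run] [//|k] kn; have [_] := run k kn; exact: newton_step_MQE.
Qed.

Lemma newton_step_descent u zeta u' :
  newton_step N ret abar beta sigma u zeta u' -> MQE N u ->
  ~ load_flow_solution N u ->
  dotp (gradQE N u) zeta < 0 /\ cost N u' < cost N u.
Proof.
move=> [dir [m [/(armijoP _ dir)[_ arm] _ ->]]] Mu nsol.
have c0 := cost_gt0 Mu nsol; case/andP: sigma01 => s0 _.
rewrite dotp_gradQE//; split; first by lra.
by rewrite (le_lt_trans arm)//; have := mulr_gt0 (mulr_gt0 s0 (step_gt0 m)) c0; lra.
Qed.

Lemma newton_step_exists u zeta m : newton_direction N u zeta ->
  armijo N ret sigma u (step m *: zeta) ->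
  exists u', newton_step N ret abar beta sigma u zeta u'.
Proof.
move=> dir arm.
have ex : exists m, `[< armijo N ret sigma u (step m *: zeta) >].
  by exists m; exact/asboolP.
case: (ex_minnP ex) => k /asboolP armk kmin.
exists (retract N ret u (step k *: zeta)); split => //; exists k; split => //.
by move=> k' k'k /asboolP /kmin; rewrite leqNgt k'k.
Qed.

(** Here rho and s stand for the residual norms before and after the step. For t in [0, 1], (1 - t +
    eta t^2)^2 <= 1 - 2 t + t^2 (1 + eta)^2, and the smallness condition bounds this by 1 - 2 sigma
    t. *)
Lemma armijo_accept (t eta rho s : R) : 0 <= t <= 1 -> 0 <= eta -> 0 <= rho ->
  t * (1 + eta) ^+ 2 <= 2 * (1 - sigma) ->
  0 <= s <= (1 - t) * rho + eta * t ^+ 2 * rho ->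
  s ^+ 2 <= (1 - 2 * sigma * t) * rho ^+ 2.
Proof.
move=> /andP[t0 t1] eta0 rho0 small /andP[s0 sle].
have sE : s <= (1 - t + eta * t ^+ 2) * rho by rewrite mulrDl.
have q0 : 0 <= 1 - t + eta * t ^+ 2.
  by rewrite addr_ge0 ?subr_ge0// mulr_ge0 ?sqr_ge0.
rewrite (@le_trans _ _ (((1 - t + eta * t ^+ 2) * rho) ^+ 2))//.
  by rewrite ler_pXn2r ?nnegrE// mulr_ge0.
rewrite exprMn ler_wpM2r ?sqr_ge0//.
have h1 : t * (t * (1 + eta) ^+ 2) <= t * (2 * (1 - sigma)) by rewrite ler_wpM2l.
have h2 : 0 <= eta * t ^+ 3 by rewrite mulr_ge0// exprn_ge0.
have h3 : 0 <= eta ^+ 2 * t ^+ 2 * (1 - t ^+ 2).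
  by rewrite !mulr_ge0 ?sqr_ge0// subr_ge0 exprn_ile1.
nra.
Qed.

Lemma residual_retract u zeta t : newton_direction N u zeta ->
  residual N (retract N ret u (t *: zeta)) =
  (1 - t) *: residual N u +
  (retract N ret u (t *: zeta) - (u + t *: zeta)) *m (matA N)^T.
Proof.
move=> /newton_directionP[_ zA]; rewrite /residual in zA *.
rewrite mulmxBl mulmxDl -scalemxAl zA.
move: (u *m _) (retract _ _ _ _ *m _) => a c.
by apply/rowP => j; rewrite !mxE; ring.
Qed.

Lemma newton_step_positive_voltages u zeta : MQE N u -> positive_voltages N u ->
  newton_direction N u zeta -> ~ load_flow_solution N u ->
  exists u', newton_step N ret abar beta sigma u zeta u'.
Proof.
move=> Mu posu dir nsol; have [zD zA] := (newton_directionP _ _ _).1 dir.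
(* The estimate is centred at u itself: no solution needs to be close. *)
have [d d0 [C C0 retC]] := retract_second_order ret Mu posu.
pose AT : {linear 'rV[R]_(4 * J) -> 'rV[R]_(3 * J)} := mulmxr (matA N)^T.
have [CA CA0 AC] := linear_rV_bounded AT.
have c0 := cost_gt0 Mu nsol.
pose rho := l2norm (residual N u).
have rho0 : 0 < rho by rewrite lt0r l2norm_ge0 andbT -sqrf_eq0 gt_eqF.
pose eta := (3 * J)%:R * (CA * (C * `|zeta| ^+ 2)) / rho.
have eta0 : 0 <= eta.
  by rewrite divr_ge0 ?(ltW rho0)// !mulr_ge0 ?sqr_ge0// ltW.
case/andP: sigma01 => s0 s1.
have s2 : 0 < 2 * (1 - sigma) by rewrite mulr_gt0// subr_gt0.
(* The three bounds give t < 1, the smallness required by [armijo_accept], and |t zeta| < d; a step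
   below e / 2 satisfies them strictly. *)
pose e := Num.min 1 (Num.min (2 * (1 - sigma) / (1 + eta) ^+ 2) (d / (`|zeta| + 1))).
have [m] : exists m, step m <= e / 2.
  apply: step_small; rewrite divr_gt0// !lt_min ltr01 !divr_gt0// ?exprn_gt0//.
  by rewrite ltr_wpDr.
set t := step m => te.
have t0 : 0 < t := step_gt0 m.
have e0 : 0 < e by move: te t0; lra.
have {}te : t < e by lra.
move: te; rewrite !lt_min => /and3P[t1 te td].
apply: (@newton_step_exists _ _ m) => //; apply/armijoP => //.
rewrite -/t.
have [dom close] : retract_defined N ret u (t *: zeta) /\
    `|retract N ret u (t *: zeta) - (u + t *: zeta)| <= C * `|t *: zeta| ^+ 2.
  apply: retC => //; first by rewrite subrr normr0.
    by rewrite -scalemxAl zD scaler0.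
  rewrite normrZ gtr0_norm//; move: td; rewrite ltr_pdivlMr ?ltr_wpDl//.
  by move: t0; lra.
split => //; apply: (@armijo_accept t eta rho); rewrite ?(ltW t0) ?(ltW t1)//.
- exact: ltW.
- by move: te; rewrite ltr_pdivlMr ?exprn_gt0 ?ltr_wpDr// => /ltW.
rewrite l2norm_ge0 residual_retract//= (le_trans (ler_l2normD _ _))// lerD//.
  by rewrite l2normZ ger0_norm// subr_ge0 ltW.
rewrite (le_trans (l2norm_le_mx_norm _))//.
rewrite (@le_trans _ _ ((3 * J)%:R * (CA * (C * `|t *: zeta| ^+ 2))))//.
  by rewrite ler_wpM2l// (le_trans (AC _))// ler_wpM2l// ltW.
rewrite normrZ (gtr0_norm t0) /eta le_eqVlt; apply/orP; left; apply/eqP.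
by field; rewrite gt_eqF.
Qed.

End Descent.

(** * Local estimates near a solution *)

Section LocalConvergence.
Variables (R : realType) (J : nat) (N : network R J) (ret : retraction).
Variables (abar beta sigma : R).
Hypotheses (abar0 : 0 < abar) (beta01 : 0 < beta < 1) (sigma01 : 0 < sigma < 1).
Implicit Types u w z zeta : 'rV[R]_(4 * J).
Local Notation step m := (beta ^+ m * abar).
Local Notation rho u := (l2norm (residual N u)).
Local Notation system u := (col_mx (jacFQE N u)^T (matA N)).

Lemma independent_rowsE u : independent_rows N u <-> row_free (system u).
Proof. by rewrite /independent_rows jacobian_FQE. Qed.

(** The system has J + 3 J = 4 J rows and is therefore square, so independent rows make its
    transpose row-free too; this survives near [ustar] with a uniform constant. *)
Lemma independent_rows_near ustar : independent_rows N ustar ->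
  exists2 C, 0 < C &
    \forall u \near ustar, forall x : 'rV[R]_(4 * J), `|x| <= C * `|x *m (system u)^T|.
Proof.
move=> /independent_rowsE free.
have freeT : row_free (system ustar)^T.
  by move: free; rewrite /row_free mxrank_tr => /eqP ->; rewrite (mulSn 3).
have [C C0 near_free] := row_free_near freeT; exists C => //.
have [/differentiable_continuous cS _] :=
  is_diff_system (matA N) (@jacFQE_affine R J N) ustar.
have cT : continuous (fun X : 'M[R]_(J + 3 * J, 4 * J) => X^T).
  apply: bounded_linear_continuous; apply/linear_boundedP.
  by near=> r => X; rewrite mx_norm_trmx ler_peMl.
exact: (continuous_comp cS (cT _) near_free).
Unshelve. all: by end_near. Qed.

Lemma newton_direction_exists u C :
  (forall x : 'rV[R]_(4 * J), `|x| <= C * `|x *m (system u)^T|) ->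
  exists zeta, newton_direction N u zeta.
Proof.
move=> /row_free_lower_bound free.
have : row_full (system u)^T.
  by move: free; rewrite /row_free /row_full => /eqP ->; rewrite (mulSn 3).
move=> /(submx_full (row_mx (0 : 'rV[R]_J) (- residual N u))) /submxP[zeta].
rewrite tr_col_mx trmxK mul_mx_row => /eq_row_mx[zD zA].
by exists zeta; apply/newton_directionP.
Qed.

Lemma solution_residual u : load_flow_solution N u -> residual N u = 0.
Proof. by move=> /load_flow_solutionE[_]; rewrite /residual => ->; rewrite subrr. Qed.

Lemma residualD u z : residual N (u + z) = residual N u + z *m (matA N)^T.
Proof. by rewrite /residual mulmxDl addrAC. Qed.

Lemma l2norm_mulmx_matA : exists2 C, 0 < C &
  forall z, l2norm (z *m (matA N)^T) <= C * `|z|.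
Proof.
pose AT : {linear 'rV[R]_(4 * J) -> 'rV[R]_(3 * J)} := mulmxr (matA N)^T.
have [C C0 AC] := linear_rV_bounded AT.
exists ((3 * J)%:R * C + 1); first by rewrite ltr_wpDl// mulr_ge0// ltW.
move=> z; rewrite (le_trans (l2norm_le_mx_norm _))//.
rewrite (@le_trans _ _ ((3 * J)%:R * (C * `|z|)))//; first by rewrite ler_wpM2l// (AC z).
by rewrite mulrA ler_wpM2r// lerDl.
Qed.

(** The uniform bound for the inverse of the system is applied twice: to ustar - u, whose image is
    the negative residual up to a quadratic term, and to the direction, whose image is exactly (0, -
    r). The last estimates then follow from [retract_second_order]. *)
Lemma local_estimates ustar : load_flow_solution N ustar ->
  positive_voltages N ustar -> independent_rows N ustar ->
  exists2 d, 0 < d & exists C1 C2, [/\ 0 < C1, 0 < C2 &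
  forall u, MQE N u -> `|u - ustar| < d ->
  [/\ `|u - ustar| <= C1 * rho u,
      exists zeta, newton_direction N u zeta,
      forall zeta, newton_direction N u zeta -> `|zeta| <= C1 * rho u &
      forall zeta t, newton_direction N u zeta -> 0 <= t <= abar -> rho u < d ->
      [/\ retract_defined N ret u (t *: zeta),
          `|retract N ret u (t *: zeta) - (u + t *: zeta)| <= C2 * (t * rho u) ^+ 2 &
          l2norm (residual N (retract N ret u (t *: zeta)) - (1 - t) *: residual N u)
            <= C2 * (t * rho u) ^+ 2]]].
Proof.
move=> sol pos indep; have [Mstar _] := (load_flow_solutionE _ _).1 sol.
have [c1 c10 nearS] := independent_rows_near indep.
have [d2 d20 [c2 c20 retC]] := retract_second_order ret Mstar pos.
have [CA CA0 AC] := l2norm_mulmx_matA.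
have [Ch Ch0 hC] := linear_rV_bounded (@hessFQE R J N).
pose Cq := 2^-1 * ((4 * J)%:R * Ch) + 1.
have Cq0 : 0 < Cq by rewrite ltr_wpDl// !mulr_ge0// ltW.
have /nbhs_normP[d1 /= d10 d1S] := nearS.
pose C1 := 2 * c1; have C10 : 0 < C1 by rewrite mulr_gt0.
(* In order: the system stays uniformly invertible, the retraction estimate applies, the quadratic
   term of the distance bound can be absorbed (hence the factor 2 in [C1]), and t zeta stays shorter
   than d2 for every t up to abar. *)
pose d := Num.min d1 (Num.min d2 (Num.min ((2 * c1 * Cq)^-1) (d2 / (abar * C1)))).
have d0 : 0 < d by rewrite !lt_min d10 d20 invr_gt0 divr_gt0 ?mulr_gt0.
have [dd1 dd2 dd3 dd4] : [/\ d <= d1, d <= d2, d <= (2 * c1 * Cq)^-1 &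
    d <= d2 / (abar * C1)].
  by split; rewrite !ge_min lexx ?orbT.
exists d => //; exists C1, (c2 * C1 ^+ 2 * (CA + 1)); split => //.
  by rewrite !mulr_gt0 ?exprn_gt0// ltr_wpDr// ltW.
move=> u Mu ud.
have uS : forall x : 'rV[R]_(4 * J), `|x| <= c1 * `|x *m (system u)^T|.
  by apply: d1S; rewrite /= distrC (lt_le_trans ud).
have dir_le zeta : newton_direction N u zeta -> `|zeta| <= C1 * rho u.
  move=> /newton_directionP[zD zA]; rewrite (le_trans (uS zeta))//.
  rewrite tr_col_mx trmxK mul_mx_row zD zA.
  rewrite (@le_trans _ _ (c1 * rho u))//.
    rewrite ler_wpM2l ?(ltW c10)// (le_trans (mx_norm_row_mx _ _))//.
    by rewrite normr0 add0r normrN mx_norm_le_l2norm.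
  by rewrite ler_wpM2r ?l2norm_ge0// /C1; lra.
split.
- pose x := ustar - u; rewrite distrC -/x.
  have xE : ustar = u + x by rewrite /x addrC subrK.
  have xD : x *m jacFQE N u = - (2^-1 *: (x *m hessFQE N x)).
    apply/eqP; rewrite -addr_eq0; have := FQE_taylor N u x.
    by rewrite -xE Mstar Mu add0r => <-.
  have xA : x *m (matA N)^T = - residual N u.
    apply/eqP; rewrite -addr_eq0 addrC; apply/eqP; have := residualD u x.
    by rewrite -xE (solution_residual sol).
  have := uS x; rewrite tr_col_mx trmxK mul_mx_row xD xA => h.
  have : `|x| <= c1 * (Cq * `|x| * `|x| + rho u).
    rewrite (le_trans h)// ler_wpM2l ?(ltW c10)// (le_trans (mx_norm_row_mx _ _))//.
    rewrite !normrN lerD ?mx_norm_le_l2norm// normrZ ger0_norm//.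
    apply: (@le_trans _ _ (2^-1 * ((4 * J)%:R * `|x| * (Ch * `|x|)))).
      rewrite ler_wpM2l// (le_trans (mx_norm_mulmx _ _))//.
      by rewrite ler_wpM2l// hC.
    rewrite [leLHS](_ : _ = 2^-1 * ((4 * J)%:R * Ch) * `|x| * `|x|); last by ring.
    by rewrite !ler_wpM2r// lerDl.
  have : c1 * Cq * `|x| <= 2^-1.
    rewrite distrC in ud; have : `|x| <= (2 * c1 * Cq)^-1 by rewrite (le_trans _ dd3)// ltW.
    rewrite -ler_pdivlMl ?mulr_gt0// => /le_trans; apply.
    by rewrite -mulrA invfM mulrC.
  have := normr_ge0 x; rewrite /C1; nra.
- exact: newton_direction_exists uS.
- exact: dir_le.
move=> zeta t dir /andP[t0 tabar] rd.
have zl := dir_le _ dir; have [zD zA] := (newton_directionP _ _ _).1 dir.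
have tz : `|t *: zeta| <= C1 * (t * rho u).
  by rewrite normrZ ger0_norm// mulrCA ler_wpM2l.
have [dom close] : retract_defined N ret u (t *: zeta) /\
    `|retract N ret u (t *: zeta) - (u + t *: zeta)| <= c2 * `|t *: zeta| ^+ 2.
  apply: retC => //; first exact: lt_le_trans dd2.
    by rewrite -scalemxAl zD scaler0.
  rewrite (le_lt_trans tz)//; move: dd4; rewrite ler_pdivlMr ?mulr_gt0// => dd4.
  apply: lt_le_trans dd4; rewrite mulrC -mulrA.
  apply: (@le_lt_trans _ _ (rho u * (abar * C1))).
    rewrite mulrCA ler_wpM2l ?l2norm_ge0// ler_wpM2r//; exact: ltW.
  by rewrite ltr_pM2r// mulr_gt0.
have close2 : `|retract N ret u (t *: zeta) - (u + t *: zeta)| <=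
    c2 * C1 ^+ 2 * (t * rho u) ^+ 2.
  rewrite (le_trans close)// -mulrA ler_wpM2l ?(ltW c20)// -exprMn.
  by rewrite ler_pXn2r ?nnegrE// (le_trans _ tz).
have pos0 : 0 <= c2 * C1 ^+ 2 * (t * rho u) ^+ 2.
  by rewrite mulr_ge0 ?sqr_ge0// mulr_ge0 ?sqr_ge0// ltW.
split => //.
- rewrite (le_trans close2)// [leRHS]mulrAC ler_peMr// lerDr; exact: ltW.
- rewrite residual_retract// addrAC subrr add0r (le_trans (AC _))//.
  rewrite (@le_trans _ _ (CA * (c2 * C1 ^+ 2 * (t * rho u) ^+ 2)))//.
    by rewrite ler_wpM2l// ltW.
  by rewrite [leRHS]mulrAC mulrC ler_wpM2l// lerDl.
Qed.

End LocalConvergence.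

(** * Invariant neighbourhood and linear decay of the cost *)

Section LocalContraction.
Variables (R : realType) (J : nat) (N : network R J) (ret : retraction).
Variables (abar beta sigma : R).
Hypotheses (abar0 : 0 < abar) (beta01 : 0 < beta < 1) (sigma01 : 0 < sigma < 1).
Implicit Types u w z zeta : 'rV[R]_(4 * J).
Local Notation step m := (beta ^+ m * abar).
Local Notation rho u := (l2norm (residual N u)).

(* Close to a solution every trial step below (1 - sigma) / 2 passes the Armijo
   test, so the accepted steps are bounded below by [min_step]. *)
Definition min_step : R := Num.min abar (beta * ((1 - sigma) / 2)).

(** The Armijo factor 1 - 2 sigma t at the lower bound for the accepted steps. *)
Definition contraction_rate : R := 1 - 2 * sigma * min_step.

Local Notation tmax := ((1 - sigma) / 2).
Local Notation tmin := min_step.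
Local Notation theta := contraction_rate.

Lemma min_step_gt0 : 0 < tmin.
Proof.
case/andP: sigma01 => s0 s1; case/andP: beta01 => b0 _.
by rewrite lt_min abar0 /= mulr_gt0// divr_gt0// subr_gt0.
Qed.

Lemma contraction_rate01 : 0 < theta < 1.
Proof.
have t0 := min_step_gt0; case/andP: sigma01 => s0 s1; case/andP: beta01 => b0 b1.
have tm : tmin <= beta * tmax by rewrite ge_min lexx orbT.
have : tmin < tmax.
  rewrite (le_lt_trans tm)// gtr_pMl// divr_gt0// subr_gt0//.
rewrite /contraction_rate => h; apply/andP; split; nra.
Qed.

(** The set [good] asks for a small residual besides closeness to [ustar]. The residual decreases,
    and the distance of the next iterate is bounded through the current residual instead of the
    current distance, so the iterates cannot drift away. *)
Lemma local_contraction ustar : load_flow_solution N ustar ->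
  positive_voltages N ustar -> independent_rows N ustar ->
  exists good : set 'rV[R]_(4 * J), exists2 C, 0 < C &
  [/\ exists2 delta, 0 < delta & forall u, MQE N u -> `|u - ustar| < delta -> good u,
      forall u, good u -> MQE N u /\ `|u - ustar| <= C * rho u,
      forall u, good u -> exists zeta u', newton_step N ret abar beta sigma u zeta u',
      forall u zeta u', good u -> newton_step N ret abar beta sigma u zeta u' ->
        good u' /\ cost N u' <= theta * cost N u &
      forall u zeta t, good u -> newton_direction N u zeta -> 0 <= t <= abar ->
        retract_defined N ret u (t *: zeta) /\
        l2norm (residual N (retract N ret u (t *: zeta)) - (1 - t) *: residual N u)
          <= C * (t * rho u) ^+ 2].
Proof.
move=> sol pos indep.
have [d d0 [C1 [C2 [C10 C20 est]]]] := local_estimates ret abar0 sol pos indep.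
have [CA CA0 AC] := l2norm_mulmx_matA N.
case/andP: (sigma01) => s0 s1; case/andP: (beta01) => b0 b1.
pose K := C1 + abar * C1 + C2 * abar ^+ 2.
have K0 : 0 < K by rewrite /K ?addr_gt0 ?mulr_gt0 ?exprn_gt0.
(* The bounds give validity of the local estimates, rho^2 <= rho, a relative retraction error C2 rho
   <= 1 (so [armijo_accept] applies with eta = 1), and K rho < d for the next iterate. *)
pose r := Num.min d (Num.min 1 (Num.min C2^-1 (d / K))).
have r0 : 0 < r by rewrite !lt_min d0 ltr01 invr_gt0 C20 divr_gt0.
have [rd r1 rC2 rK] : [/\ r <= d, r <= 1, r <= C2^-1 & r <= d / K].
  by split; rewrite !ge_min lexx ?orbT.
pose good : set 'rV[R]_(4 * J) := [set u | [/\ MQE N u, `|u - ustar| < d & rho u < r]].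
exists good; exists (C1 + C2); first exact: addr_gt0.
have small u zeta t : good u -> newton_direction N u zeta -> 0 <= t <= tmax ->
    t <= abar -> armijo N ret sigma u (t *: zeta).
  move=> [Mu ud ur] dir /andP[t0 tm] ta; apply/armijoP => //.
  have [_ _ _ close] := est u Mu ud.
  have [|dom _ res] := close zeta t dir _ (lt_le_trans ur rd); first exact/andP.
  split => //; apply: (armijo_accept (eta := 1)) => //.
  - by rewrite t0 /=; move: tm; lra.
  - exact: l2norm_ge0.
  - by move: tm; lra.
  rewrite l2norm_ge0 /=.
  rewrite -[X in l2norm X](subrK ((1 - t) *: residual N u)) addrC.
  rewrite (le_trans (ler_l2normD _ _))// lerD//.
    rewrite l2normZ ger0_norm// subr_ge0; move: tm; lra.
  rewrite (le_trans res)// exprMn mul1r mulrCA ler_wpM2l ?sqr_ge0//.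
  rewrite expr2 mulrA -[leRHS]mul1r ler_wpM2r ?l2norm_ge0//.
  by rewrite -ler_pdivlMl// mulr1 (le_trans (ltW ur)).
split.
- exists (Num.min d (r / CA)); first by rewrite lt_min d0 divr_gt0.
  move=> u Mu; rewrite lt_min => /andP[ud uA]; split => //.
  rewrite -[u](subrK ustar) addrC residualD (solution_residual sol) add0r.
  by rewrite (le_lt_trans (AC _))// mulrC -ltr_pdivlMr.
- move=> u [Mu ud ur]; have [h _ _ _] := est u Mu ud; split => //.
  by rewrite (le_trans h)// ler_wpM2r ?l2norm_ge0// lerDl ltW.
- move=> u gu; have [Mu ud ur] := gu; have [_ [zeta dir] _ _] := est u Mu ud.
  have tm0 : 0 < tmax by rewrite divr_gt0// subr_gt0.
  have [m mt] := step_small abar0 beta01 tm0.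
  exists zeta; apply: (@newton_step_exists _ _ _ _ _ _ _ _ _ m) => //.
  apply: small => //; last exact: step_le.
  by rewrite mt ltW// step_gt0.
- move=> u zeta u' gu [dir [m [arm rej ->]]].
  have [Mu ud ur] := gu; have [h1 _ h2 close] := est u Mu ud.
  have t0 := step_gt0 abar0 beta01 m; have ta := step_le abar0 beta01 m.
  (* Either the first trial abar is accepted, or the preceding trial was rejected and so was not
     below (1 - sigma) / 2; one factor beta is lost. *)
  have tmin_le : tmin <= step m.
    case: m rej {arm t0 ta} => [_|m rej]; first by rewrite mul1r ge_min lexx.
    rewrite ge_min; apply/orP; right; rewrite exprS -mulrA ler_pM2l//.
    rewrite leNgt; apply/negP => mt; apply: (rej m (leqnn _)).
    by apply: small; rewrite ?step_le// (ltW mt) ltW// step_gt0.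
  have [|dom pclose _] := close zeta (step m) dir _ (lt_le_trans ur rd).
    by rewrite (ltW t0).
  have costle : cost N (retract N ret u (step m *: zeta)) <= theta * cost N u.
    have [_ le1] := (armijoP ret sigma (step m) dir).1 arm.
    rewrite (le_trans le1)// ler_wpM2r ?sqr_ge0// lerD2l lerN2.
    by rewrite ler_wpM2l// mulr_ge0// ltW.
  split => //; split; first exact: retract_MQE.
    have -> : retract N ret u (step m *: zeta) - ustar =
        (u - ustar) + step m *: zeta
        + (retract N ret u (step m *: zeta) - (u + step m *: zeta)).
      move: (retract N ret u (step m *: zeta)) (step m *: zeta) => x y.
      by apply/rowP => j; rewrite !mxE; ring.
    have rho0 := l2norm_ge0 (residual N u).
    apply: (@le_lt_trans _ _ (K * rho u)).
      rewrite !mulrDl (le_trans (ler_normD _ _))// lerD//.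
        rewrite (le_trans (ler_normD _ _))// lerD// normrZ gtr0_norm// -[leRHS]mulrA.
        by rewrite ler_pM ?(ltW t0)//; exact: h2.
      rewrite (le_trans pclose)// [(step m * _) ^+ 2]exprMn -[leRHS]mulrA ler_pM2l// ler_pM ?sqr_ge0//.
        by rewrite ler_pXn2r ?nnegrE ?(ltW t0) ?(ltW abar0).
      by rewrite expr2 ler_piMl// (le_trans (ltW ur)).
    by rewrite mulrC -ltr_pdivlMr// (lt_le_trans ur).
  rewrite (le_lt_trans _ ur)// -(@ler_pXn2r _ 2)// ?nnegrE ?l2norm_ge0//.
  rewrite (le_trans costle)// ler_piMl ?sqr_ge0//; case/andP: contraction_rate01 => _; exact: ltW.
move=> u zeta t [Mu ud ur] dir t01; have [_ _ _ close] := est u Mu ud.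
have [dom _ h] := close zeta t dir t01 (lt_le_trans ur rd); split => //.
by rewrite (le_trans h)// ler_wpM2r ?sqr_ge0// lerDr ltW.
Qed.

End LocalContraction.

(** * Convergence *)

Section Convergence.
Variables (R : realType) (J : nat) (N : network R J) (ret : retraction).
Variables (abar beta sigma : R).
Hypotheses (abar0 : 0 < abar) (beta01 : 0 < beta < 1) (sigma01 : 0 < sigma < 1).
Implicit Types w z : 'rV[R]_(4 * J).
Local Notation step m := (beta ^+ m * abar).
Local Notation rho u := (l2norm (residual N u)).

Lemma geometric_cvg0 (theta C : R) (s : nat -> R) : 0 < theta < 1 ->
  (forall k, 0 <= s k) -> (forall k, s k ^+ 2 <= C * theta ^+ k) ->
  s @ \oo --> (0 : R).
Proof.
move=> /andP[t0 t1] s0 sC; apply/cvgr0Pnorm_lt => e e0.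
have gcvg : (fun k => C * theta ^+ k) @ \oo --> C * (0 : R).
  by apply: cvgMr; apply: cvg_expr; rewrite ger0_norm// ltW.
rewrite mulr0 in gcvg; move/cvgr0Pnorm_lt: gcvg => /(_ _ (exprn_gt0 2 e0)).
apply: filterS => k h; rewrite ger0_norm// -(@ltr_pXn2r _ 2)// ?nnegrE ?(ltW e0)//.
by rewrite (le_lt_trans (sC k))// (le_lt_trans _ h)// ler_norm.
Qed.

(* A trial step a > 1 leaves a residual of norm about (a - 1) rho, too large for
   the Armijo rule when a > 2 (1 - sigma). *)
Lemma armijo_reject (t rho s eta g : R) : 0 < rho -> 0 <= eta ->
  sigma < 2^-1 -> 0 <= t <= abar -> 0 < g -> 2 * (1 - sigma) + g <= t ->
  2 * abar ^+ 2 * eta < g -> (t - 1) * rho - eta * t ^+ 2 * rho <= s ->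
  s ^+ 2 <= (1 - 2 * sigma * t) * rho ^+ 2 -> False.
Proof.
move=> rho0 eta0 sig /andP[t0 ta] g0 gt small slow supp.
have ta2 : t ^+ 2 <= abar ^+ 2 by rewrite ler_pXn2r ?nnegrE ?(ltW abar0).
have h1 : eta * t ^+ 2 <= eta * abar ^+ 2 by rewrite ler_wpM2l.
have t1 : 1 + g <= t by lra.
have q0 : 0 <= t - 1 - eta * t ^+ 2 by nra.
have : ((t - 1 - eta * t ^+ 2) * rho) ^+ 2 <= (1 - 2 * sigma * t) * rho ^+ 2.
  have lo : (t - 1 - eta * t ^+ 2) * rho <= s by rewrite mulrBl.
  have lo0 : 0 <= (t - 1 - eta * t ^+ 2) * rho by rewrite mulr_ge0// ltW.
  by apply: le_trans supp; rewrite ler_pXn2r ?nnegrE// (le_trans lo0).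
rewrite exprMn ler_pM2r ?exprn_gt0// => h2.
(* Expanding the square and discarding (eta t^2)^2 gives this; division by t then yields g <= 2
   abar^2 eta, a contradiction. *)
have h3 : t * (t - 2 * (1 - sigma)) <= t * (2 * (t - 1) * eta * t).
  have : 0 <= (eta * t ^+ 2) ^+ 2 by exact: sqr_ge0.
  nra.
have tp : 0 < t by lra.
rewrite ler_pM2l// in h3.
have : 2 * (t - 1) * eta * t <= 2 * abar ^+ 2 * eta.
  have : 0 <= eta * t by rewrite mulr_ge0// ltW.
  nra.
lra.
Qed.

(** The trials decrease with m, so the last one before the unit step already realises the smallest
    gap above 2 (1 - sigma). *)
Lemma unit_step_gap : unit_step_scalars abar beta sigma ->
  exists n, [/\ step n = 1, 1 <= abar & exists2 g, 0 < g &
    forall m, (m < n)%N -> 2 * (1 - sigma) + g <= step m].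
Proof.
move=> [_ [n [n1 big]]]; exists n; split => //.
  by rewrite -n1; exact: step_le.
have [b0 b1] := andP beta01.
(* With n = 0 no trial precedes the unit step and any positive gap will do. *)
case: n n1 big => [|n] n1 big; first by exists 1.
exists (step n - 2 * (1 - sigma)); first by rewrite subr_gt0 big.
move=> m; rewrite ltnS => mn; rewrite addrC subrK ler_wpM2r ?(ltW abar0)//.
by rewrite ler_wiXn2l// ltW.
Qed.

(** For t = 1 the linear part (1 - t) r vanishes and only the quadratic retraction error remains, so
    it suffices that t = 1 is the trial selected. *)
Lemma newton_step_quadratic C : 0 < C -> unit_step_scalars abar beta sigma ->
  exists2 r, 0 < r & forall u zeta u',
    (forall t, 0 <= t <= abar -> retract_defined N ret u (t *: zeta) /\
      l2norm (residual N (retract N ret u (t *: zeta)) - (1 - t) *: residual N u)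
        <= C * (t * rho u) ^+ 2) ->
    0 < rho u < r -> newton_step N ret abar beta sigma u zeta u' ->
    rho u' <= C * rho u ^+ 2.
Proof.
move=> C0 unit; have [n [n1 a1 [g g0 gap]]] := unit_step_gap unit.
case: unit => sig _; case/andP: (sigma01) => s0 s1.
have ga0 : 0 < 2 * abar ^+ 2 * C by rewrite !mulr_gt0// exprn_gt0.
(* The first bound makes eta = C rho small enough for [armijo_reject] on the earlier trials; the
   second gives (C rho)^2 <= 1 - 2 sigma, which accepts t = 1. *)
pose r := Num.min (g / (2 * abar ^+ 2 * C)) ((1 - 2 * sigma) / C).
have s2 : 0 < 1 - 2 * sigma by lra.
exists r; first by rewrite lt_min !divr_gt0.
move=> u zeta u' close; rewrite lt_min !ltr_pdivlMr// => /and3P[rho0 rg rs].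
move=> [dir [m [arm rej ->]]].
have dominated t : (t * rho u) ^+ 2 * C = (C * rho u) * t ^+ 2 * rho u by ring.
have [dom1 res1] := close 1 (introT andP (conj ler01 a1)).
rewrite subrr scale0r subr0 mul1r in res1.
have arm1 : armijo N ret sigma u (1 *: zeta).
  apply/armijoP => //; split => //; rewrite /cost.
  apply: (@le_trans _ _ ((C * rho u ^+ 2) ^+ 2)).
    by rewrite ler_pXn2r ?nnegrE ?l2norm_ge0// mulr_ge0 ?sqr_ge0// ltW.
  rewrite mulr1 [C * _](_ : _ = (C * rho u) * rho u); last by ring.
  rewrite exprMn ler_wpM2r ?sqr_ge0//.
  have : 0 <= C * rho u by rewrite mulr_ge0// ltW.
  by move: rs; nra.
case: (ltngtP m n) => [mn|nm|->]; last by rewrite n1.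
- exfalso; have [_] := (armijoP ret sigma (step m) dir).1 arm.
  have t0 := step_gt0 abar0 beta01 m; have ta := step_le abar0 beta01 m.
  have tb : 0 <= step m <= abar by rewrite (ltW t0).
  have [_ res] := close _ tb.
  apply: (@armijo_reject _ _ _ (C * rho u) g) => //.
  + by rewrite mulr_ge0 ?l2norm_ge0// ltW.
  + exact: gap.
  + by move: rg; lra.
  rewrite -[X in _ <= l2norm X](subrK ((1 - step m) *: residual N u)).
  rewrite [X in _ <= l2norm X]addrC (le_trans _ (ler_l2normB _ _))// lerB//.
    by rewrite l2normZ distrC ler_wpM2r ?l2norm_ge0// ler_norm.
  by rewrite (le_trans res)// mulrC dominated.
- by exfalso; apply: (rej n nm); rewrite n1.
Qed.

End Convergence.

Theorem proposition2 (R : realType) (J : nat) (N : network R J)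
    (hsol : exists u, load_flow_solution N u)
    (ret : retraction) (abar beta sigma : R)
    (habar : 0 < abar) (hbeta : 0 < beta < 1) (hsigma : 0 < sigma < 1) :
  (* Riemannian approximate Newton method *)
  (exists E : 'rV[R]_(4 * J) -> 'M[R]_(4 * J),
     (forall stop n u zeta,
        newton_run N ret abar beta sigma stop n u zeta ->
        forall k, (k < n)%N -> regular_point N (u k) ->
          stablemx (tangentQE N (u k)) (E (u k)) /\
          hessQE N (u k) (zeta k) + zeta k *m E (u k) = - gradQE N (u k)) /\
     (forall K : set 'rV[R]_(4 * J),
        compact K -> (forall w, K w -> independent_rows N w) ->
        exists gamma : R, forall stop n u zeta,
          newton_run N ret abar beta sigma stop n u zeta ->
          forall k, (k < n)%N -> K (u k) ->
            opnorm2 (E (u k)) <= gamma * l2norm (gradQE N (u k)))) /\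
  (* guaranteed descent *)
  (forall stop n u zeta,
     newton_run N ret abar beta sigma stop n u zeta ->
     forall k, (k < n)%N -> ~ load_flow_solution N (u k) ->
       dotp (gradQE N (u k)) (zeta k) < 0 /\
       cost N (u k.+1) < cost N (u k)) /\
  (forall u zeta,
     MQE N u -> positive_voltages N u -> newton_direction N u zeta ->
     ~ load_flow_solution N u ->
     exists u', newton_step N ret abar beta sigma u zeta u') /\
  (* local superlinear convergence *)
  (forall ustar,
     load_flow_solution N ustar -> positive_voltages N ustar ->
     independent_rows N ustar ->
     exists2 delta : R, 0 < delta &
       forall u0, MQE N u0 -> l2norm (u0 - ustar) < delta ->
         (exists u zeta, u 0%N = u0 /\
            forall n, newton_run N ret abar beta sigma None n u zeta) /\
         (forall u zeta, u 0%N = u0 ->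
            (forall n, newton_run N ret abar beta sigma None n u zeta) ->
            u @ \oo --> ustar /\
            (unit_step_scalars abar beta sigma -> superlinear_to u ustar))).
Proof.
split.
  exists (newton_error (jacFQE N) (@hessFQE R J N) (matA N) (vecb N)); split.
    move=> stop n u zeta run k kn reg; have [_ steps] := run.
    have [_ [/newton_directionP[_ zA] _]] := steps k kn; split.
      exact: (stablemx_newton_error _ _ (@FQE_taylor R J N)).
    apply: (rhess_newton (@jacFQE_affine R J N) (@FQE_taylor R J N)) => //.
    by move: reg; rewrite /regular_point jacobian_FQE.
  move=> K cK Kind.
  have [gamma bound] := newton_error_bound (vecb N) (@jacFQE_affine R J N)
    (@FQE_taylor R J N) cK (fun w Kw => (independent_rowsE N w).1 (Kind w Kw)).
  by exists gamma => stop n u zeta _ k _; exact: bound.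
split.
  move=> stop n u zeta run k kn nsol; have [_ /(_ k kn)[_ st]] := run.
  apply: newton_step_descent st _ nsol => //.
  exact: newton_run_MQE run _ (ltnW kn).
split; first by move=> u zeta; exact: newton_step_positive_voltages.
move=> ustar sol pos indep.
have [good [C C0 [[d d0 near_good] good_le good_step good_stable good_res]]] :=
  local_contraction ret habar hbeta hsigma sol pos indep.
have theta01 := contraction_rate01 habar hbeta hsigma.
set theta := contraction_rate abar beta sigma in good_stable theta01.
exists d => // u0 M0 u0d.
have good0 : good u0.
  by apply: near_good => //; rewrite (le_lt_trans (mx_norm_le_l2norm _)).
split.
  (* A total choice function builds the run; its value outside [good] is a dummy, as the iterates
     never leave [good]. *)
  have next u : exists p : 'rV[R]_(4 * J) * 'rV[R]_(4 * J),
      good u -> newton_step N ret abar beta sigma u p.1 p.2.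
    have [gu|ngu] := pselect (good u); last by exists (0, 0).
    by have [zeta [u' st]] := good_step u gu; exists (zeta, u').
  have [F FP] := choice next.
  pose u := fix it k := if k is k'.+1 then (F (it k')).2 else u0.
  exists u, (fun k => (F (u k)).1); split => // n; split => // k _; split => //.
  have gu : good (u k).
    by elim: k => // k IH; have [] := good_stable _ _ _ IH (FP _ IH).
  exact: FP.
move=> u zeta u00 run.
have st k : newton_step N ret abar beta sigma (u k) (zeta k) (u k.+1).
  by have [_ /(_ k (ltnSn k))[]] := run k.+1.
have gu k : good (u k).
  by elim: k => [|k IH]; [rewrite u00|have [] := good_stable _ _ _ IH (st k)].
have costk k : l2norm (residual N (u k)) ^+ 2 <= cost N u0 * theta ^+ k.
  rewrite -/(cost N (u k)); elim: k => [|k IH]; first by rewrite u00 mulr1.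
  have [_ h] := good_stable _ _ _ (gu k) (st k); rewrite (le_trans h)//.
  rewrite exprS [leRHS]mulrCA ler_wpM2l//; by case/andP: theta01 => /ltW.
have rho0 : l2norm (residual N (u k)) @[k --> \oo] --> (0 : R).
  by apply: (geometric_cvg0 theta01) => [k|k]; [exact: l2norm_ge0|exact: costk].
have dist_le k : `|u k - ustar| <= C * l2norm (residual N (u k)).
  by have [] := good_le _ (gu k).
have ucvg : u @ \oo --> ustar.
  apply/cvgrPdist_lt => e e0; move/cvgr0Pnorm_lt: rho0 => /(_ _ (divr_gt0 e0 C0)).
  apply: filterS => k; rewrite ger0_norm ?l2norm_ge0// ltr_pdivlMr// mulrC => h.
  by rewrite distrC (le_lt_trans (dist_le k)).
split => // unit une.
have [r r0 quad] := newton_step_quadratic N ret habar hbeta hsigma C0 unit.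
have [CA CA0 AC] := l2norm_mulmx_matA N.
pose K := (4 * J)%:R * C * C * CA + 1.
have K0 : 0 < K by rewrite ltr_wpDl// !mulr_ge0// ltW.
(* The distance is bounded by the residual, so an iterate other than [ustar] has a nonzero
   residual. *)
have rhopos k : 0 < l2norm (residual N (u k)).
  rewrite lt0r l2norm_ge0 andbT; apply/eqP => z0; have := dist_le k.
  by rewrite z0 mulr0 normr_le0 subr_eq0 (negPf (une k)).
have rho_le k : l2norm (residual N (u k)) <= CA * l2norm (u k - ustar).
  rewrite -{1}[u k](subrK ustar) addrC residualD (solution_residual sol) add0r.
  by rewrite (le_trans (AC _))// ler_wpM2l ?(ltW CA0)// mx_norm_le_l2norm.
have upos k : 0 < l2norm (u k - ustar).
  by rewrite lt0r l2norm_ge0 andbT l2norm_eq0 subr_eq0 une.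
apply/cvgr0Pnorm_lt => e e0.
have e1 : 0 < e / K by rewrite divr_gt0.
move/cvgr0Pnorm_lt: rho0 => rho0.
apply: filterS2 (rho0 _ e1) (rho0 _ r0) => k.
rewrite !(ger0_norm (l2norm_ge0 _)) => ke kr.
rewrite ger0_norm ?divr_ge0 ?l2norm_ge0// ltr_pdivrMr//.
have q : l2norm (residual N (u k.+1)) <= C * l2norm (residual N (u k)) ^+ 2.
  apply: (quad _ _ _ _ _ (st k)); last by rewrite rhopos.
  by move=> t tb; apply: good_res => //; have [] := st k.
set rho := l2norm (residual N (u k)) in q ke *.
(* Distance is at most C times the residual, the residual is squared by the step, and one of the two
   factors rho is at most CA times the old distance; the ratio is thus O(rho). The factor 4 J passes
   from the max norm to the Euclidean one. *)
have h1 : l2norm (u k.+1 - ustar) <= (4 * J)%:R * (C * (C * rho ^+ 2)).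
  rewrite (le_trans (l2norm_le_mx_norm _))// ler_wpM2l//.
  by rewrite (le_trans (dist_le _))// ler_wpM2l// ltW.
rewrite (le_lt_trans h1)//; rewrite ltr_pdivlMr// in ke.
have h2 : (4 * J)%:R * C * C * CA * rho < e.
  by rewrite (le_lt_trans _ ke)// mulrC ler_wpM2l ?l2norm_ge0// lerDl.
apply: le_lt_trans (_ : (4 * J)%:R * C * C * CA * rho * l2norm (u k - ustar) < _).
  rewrite [leLHS](_ : _ = (4 * J)%:R * C * C * rho * rho); last by ring.
  rewrite [leRHS](_ : _ = (4 * J)%:R * C * C * rho * (CA * l2norm (u k - ustar))).
    apply: ler_wpM2l; last exact: rho_le.
    by rewrite !mulr_ge0 ?l2norm_ge0// ltW.
  by ring.
by rewrite ltr_pM2r.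
Qed.
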